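(* Let $(B,g_B)$ be a Riemannian manifold, let $S\in C^\infty(B)$ be positive, and let $\Omega\subset B$ be a precompact domain with smooth boundary $\partial\Omega$. Consider the Dirichlet eigenvalue problem $$\text{(D)}\qquad \mathscr{L}_S^{+}\varphi = \lambda \varphi \ \text{ in } \Omega,\qquad \varphi = 0 \ \text{ on } \partial \Omega,$$ for functions $\varphi\in C^\infty(\overline\Omega)$, and the divergence-free boundary eigenvalue problem $$\text{(F)}\qquad \mathscr{L}_S^{-}X = \lambda X \ \text{ in } \Omega,\qquad \operatorname{div}(X) = 0 \ \text{ on } \partial \Omega,$$ for smooth vector fields $X\in\mathfrak{X}(\overline\Omega)$. Then the following statements hold: 1. If $\lambda \neq 0$ and $\varphi$ is a nontrivial solution of (D), then $X := \mathcal{A}_S \varphi = -S \nabla \varphi$ is a nontrivial solution of (F) with the same eigenvalue $\lambda$. 2. If $\lambda \neq 0$ and $X$ is a nontrivial solution of (F), then $\varphi:=\mathcal{A}^\dagger_S X=\frac{1}{S}\operatorname{div}(X)$ is a nontrivial solution of (D) with the same eigenvalue $\lambda$. Consequently, the nonzero Dirichlet spectrum of $\mathscr{L}_S^{+}$ (the nonzero eigenvalues of (D)) coincides with the nonzero divergence-free boundary spectrum of $\mathscr{L}_S^{-}$ (the nonzero eigenvalues of (F)), counting multiplicities.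
   Context: Here $\nabla$ and $\operatorname{div}$ are the gradient and divergence of $(B,g_B)$. The operators are $$\mathcal{A}_S\varphi=-S\nabla\varphi,\qquad \mathcal{A}_S^\dagger X=\frac1S\operatorname{div}(X),$$ $$\mathscr{L}_S^{+}\varphi=\mathcal{A}_S^\dagger\mathcal{A}_S\varphi=-\frac1S\operatorname{div}(S\nabla\varphi),\qquad \mathscr{L}_S^{-}X=\mathcal{A}_S\mathcal{A}_S^\dagger X=-S\,\nabla\!\left(\frac{\operatorname{div}(X)}{S}\right),$$ acting on smooth functions $\varphi$ and smooth vector fields $X$ respectively. A domain is a connected open set. The multiplicity of an eigenvalue is the dimension of the space of solutions of the corresponding boundary value problem. *)

(* Defs.v *)
From HB Require Import structures.
From mathcomp Require Import all_boot all_order all_algebra.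
From mathcomp Require Import all_classical all_reals all_analysis.
Import Order.TTheory GRing.Theory Num.Theory.
Import numFieldNormedType.Exports.

Set Implicit Arguments.
Unset Strict Implicit.
Unset Printing Implicit Defensive.

Local Open Scope classical_set_scope.
Local Open Scope ring_scope.

Section EuclideanSmoothness.
Context {R : realType} {n : nat} {W : normedModType R}.
Implicit Types (U : set 'rV[R]_n) (f : 'rV[R]_n -> W).

(* U is meant to be open. As 'rV_n is finite dimensional, f is C^(k+1) iff it
   is Frechet differentiable and x |-> df_x(v) is C^k for every vector v. *)
Fixpoint Ck (k : nat) U f : Prop :=
  match k with
  | 0 => forall x, U x -> {for x, continuous f}
  | k'.+1 => (forall x, U x -> differentiable f x) /\
             (forall v : 'rV[R]_n, Ck k' U ('D_v f))
  end.

Definition smooth U f : Prop := forall k, Ck k U f.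

End EuclideanSmoothness.

(* A homeomorphism from the open set cdom onto an open subset of R^n; outside
   of cdom and of its image, cfun and cinv take arbitrary values. *)
Record chart (R : realType) (n : nat) (B : topologicalType) := Chart {
  cdom : set B ;
  cfun :> B -> 'rV[R]_n ;
  cinv : 'rV[R]_n -> B ;
  cdom_open : open cdom ;
  cimg_open : open (cfun @` cdom) ;
  cfunK : forall p, cdom p -> cinv (cfun p) = p ;
  cfun_cts : forall p, cdom p -> {for p, continuous cfun} ;
  cinv_cts : forall x, (cfun @` cdom) x -> {for x, continuous cinv} }.

Section Charts.
Context {R : realType} {n : nat} {B : topologicalType}.

Definition chart_img (U : set B) (c : chart R n B) : set 'rV[R]_n :=
  c @` (U `&` cdom c).

Definition transition (c d : chart R n B) : 'rV[R]_n -> 'rV[R]_n :=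
  d \o cinv c.

Definition compatible (c d : chart R n B) : Prop :=
  smooth (chart_img (cdom d) c) (transition c d) /\
  smooth (chart_img (cdom c) d) (transition d c).

End Charts.

(* chart_at selects, once and for all, a chart of the atlas around each point.
   The atlas need not be maximal. *)
Record smoothManifold (R : realType) (n : nat) (B : topologicalType) :=
  SmoothManifold {
  atlas : set (chart R n B) ;
  chart_at : B -> chart R n B ;
  atlas_compatible : forall c d, atlas c -> atlas d -> compatible c d ;
  atlas_chart_at : forall p, atlas (chart_at p) ;
  mem_chart_at : forall p, cdom (chart_at p) p ;
  manifold_hausdorff : hausdorff_space B ;
  manifold_second_countable : @second_countable B }.

Section Calculus.
Context {R : realType} {n : nat} {B : topologicalType}.
Variable M : smoothManifold R n B.
Implicit Types (U A Om : set B) (f phi S : B -> R) (p : B).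

(* A tangent vector at p is represented by the row of its components in the
   chart [chart_at M p]; a vector field is thus a function X : B -> 'rV_n whose
   value X p is written in the coordinates given by [chart_at M p]. *)
Implicit Types (X : B -> 'rV[R]_n).

(* The components in the chart c of the tangent vector v at p. *)
Definition components (c : chart R n B) p (v : 'rV[R]_n) : 'rV[R]_n :=
  v *m jacobian (transition (chart_at M p) c) (chart_at M p p).

(* The coordinate vector field d/dx^i of the chart c, at p. *)
Definition coord_field (c : chart R n B) (i : 'I_n) p : 'rV[R]_n :=
  'e_i *m jacobian (transition c (chart_at M p)) (c p).

(* X in the coordinates of c, as a function on the image of c. *)
Definition local_field (c : chart R n B) X (x : 'rV[R]_n) : 'rV[R]_n :=
  components c (cinv c x) (X (cinv c x)).

Definition smooth_fun U f : Prop :=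
  forall c, atlas M c -> smooth (chart_img U c) (f \o cinv c).

Definition smooth_field U X : Prop :=
  forall c, atlas M c -> smooth (chart_img U c) (local_field c X).

(* Smoothness on an arbitrary subset: existence of local smooth extensions. *)
Definition smooth_fun_on A f : Prop :=
  forall p, A p -> exists U : set B, exists f' : B -> R,
    [/\ open U, U p, smooth_fun U f' & forall q, (U `&` A) q -> f q = f' q].

Definition smooth_field_on A X : Prop :=
  forall p, A p -> exists U : set B, exists X' : B -> 'rV[R]_n,
    [/\ open U, U p, smooth_field U X' & forall q, (U `&` A) q -> X q = X' q].

(* The matrix (G p) represents the inner product on the tangent space at p,
   and [gram G c p] is the usual matrix (g_ij) of the metric in the chart c. *)
Definition inner (G : B -> 'M[R]_n) p (v w : 'rV[R]_n) : R :=
  (v *m G p *m w^T) 0 0.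

Definition gram (G : B -> 'M[R]_n) (c : chart R n B) p : 'M[R]_n :=
  \matrix_(i, j) inner G p (coord_field c i p) (coord_field c j p).

Record riemannianMetric := RiemannianMetric {
  metric_mx :> B -> 'M[R]_n ;
  metric_sym : forall p v w, inner metric_mx p v w = inner metric_mx p w v ;
  metric_pos : forall p v, v != 0 -> 0 < inner metric_mx p v v ;
  metric_smooth : forall c, atlas M c ->
    smooth (chart_img setT c) (gram metric_mx c \o cinv c) }.

Variable g : riemannianMetric.

(* (grad phi)^j = sum_i (d phi / d x^i) g^{ij}, in the chart [chart_at M p]. *)
Definition grad phi p : 'rV[R]_n :=
  (\row_i 'D_('e_i) (phi \o cinv (chart_at M p)) (chart_at M p p))
    *m invmx (g p).

(* div X = |g|^(-1/2) sum_i d(|g|^(1/2) X^i) / d x^i, in [chart_at M p]. *)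
Definition div X p : R :=
  let c := chart_at M p in
  let vol := fun x : 'rV[R]_n => Num.sqrt (\det (gram g c (cinv c x))) in
  (vol (c p))^-1 *
    \sum_(i < n) 'D_('e_i) (fun x => vol x * local_field c X x 0 i) (c p).

Definition A_op S phi p : 'rV[R]_n := - S p *: grad phi p.

Definition Adag_op S X p : R := (S p)^-1 * div X p.

Definition L_plus S phi : B -> R := Adag_op S (A_op S phi).

Definition L_minus S X : B -> 'rV[R]_n := A_op S (Adag_op S X).

Definition domain Om : Prop := open Om /\ connected Om.

(* The topological boundary of an open set. *)
Definition bdry Om : set B := closure Om `\` Om.

(* Near each boundary point, Om is a half-space in a smooth chart. *)
Definition smooth_boundary Om : Prop :=
  forall p, bdry Om p -> exists (c : chart R n B) (i : 'I_n),
    [/\ forall d, atlas M d -> compatible c d, cdom c p &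
        forall q, cdom c q -> (Om q <-> 0 < c q 0 i)].

(* Functions and vector fields on closure Om are represented by the functions
   and vector fields on B which vanish outside of closure Om. The next two
   definitions extend a function, resp. a vector field, from Om to closure Om
   by continuity; vectors are compared in one chart to take the limit. They
   give the boundary values of grad phi and div X when phi and X are only
   given on closure Om. *)
Definition extend_fun Om f p : R :=
  if p \in Om then f p
  else if p \in closure Om then lim (f q @[q --> within Om (nbhs p)])
  else 0.

Definition extend_field Om X p : 'rV[R]_n :=
  if p \in Om then X p
  else if p \in closure Om then
    lim (components (chart_at M p) q (X q) @[q --> within Om (nbhs p)])
  else 0.

Definition dirichlet S Om (lambda : R) : set (B -> R) :=
  [set phi | [/\ forall p, ~ closure Om p -> phi p = 0,
                 smooth_fun_on (closure Om) phi,
                 forall p, Om p -> L_plus S phi p = lambda * phi p &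
                 forall p, bdry Om p -> phi p = 0]].

Definition divfree S Om (lambda : R) : set (B -> 'rV[R]_n) :=
  [set X | [/\ forall p, ~ closure Om p -> X p = 0,
               smooth_field_on (closure Om) X,
               forall p, Om p -> L_minus S X p = lambda *: X p &
               forall p, bdry Om p -> extend_fun Om (div X) p = 0]].

End Calculus.

Section Eigenspaces.
Context {R : realType} {E : lmodType R}.

Definition nontrivial_solution (V : set E) (u : E) : Prop := V u /\ u <> 0.

Definition lin_indep (k : nat) (u : 'I_k -> E) : Prop :=
  forall a : 'I_k -> R, \sum_(i < k) a i *: u i = 0 -> forall i, a i = 0.

(* The dimension of a linear subspace, +oo if it is infinite dimensional. *)
Definition dimension (V : set E) : \bar R :=
  ereal_sup [set (k%:R%:E)%E | k in [set k : nat |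
    exists u : 'I_k -> E, (forall i, V (u i)) /\ lin_indep u]].

(* sol lambda is the space of solutions for the parameter lambda. *)
Definition nonzero_spectrum (sol : R -> set E) : set R :=
  [set lambda | lambda <> 0 /\ exists u, nontrivial_solution (sol lambda) u].

Definition multiplicity (sol : R -> set E) (lambda : R) : \bar R :=
  dimension (sol lambda).

End Eigenspaces.

(* Main.v *)
(* The operators intertwine: if L+ phi = lambda phi and X = A phi, then
   A^dagger X = lambda phi, hence L- X = lambda X; symmetrically for
   phi = A^dagger X. On the boundary div X = lambda S phi, so the two boundary
   conditions correspond to each other. As the two maps are linear and their
   composites are lambda times the identity, they preserve linear independence
   when lambda <> 0, so the eigenspaces have the same dimension.
   The analytic content is that A and A^dagger preserve smoothness up to the
   boundary. Since grad and div are defined in a chart that depends on the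
   point, this rests on their invariance under changes of charts, which for div
   follows from the Piola identity. *)

Require Import Defs.
From mathcomp Require Import all_boot all_order all_algebra.
From mathcomp Require Import all_classical all_reals all_analysis.
From mathcomp Require Import perm.
Import Order.TTheory GRing.Theory Num.Theory.
Import numFieldNormedType.Exports.

Set Implicit Arguments.
Unset Strict Implicit.
Unset Printing Implicit Defensive.

Local Open Scope classical_set_scope.
Local Open Scope ring_scope.

(** * Calculus of C^k functions on open subsets of R^n *)

Section Germs.
Context {R : realType} {V W : normedModType R}.

(** The chart that [chart_at] picks may jump from point to point, so neither [grad] nor [div] is
    given by a single formula near a point. Smoothness can be read off only after both have been
    rewritten in one fixed chart of the atlas. For [div] the difficulty is the volume density: it
    scales by the absolute value of the Jacobian determinant, no orientation being given, so the
    sign must be frozen locally before differentiating. The second obstacle is the boundary.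
    Solutions live on the closure of Om, and the boundary values of A phi and of div X are limits
    from inside. They are computed through local smooth extensions: the operators are local, so
    applied to an extension they agree on Om with the original, and the result is continuous at the
    boundary point. Only such an argument shows that [lim] is a genuine limit. Since [derive] is
    total, linearity of the operators also holds only under differentiability, and each algebraic
    step carries the smoothness of its arguments. *)

Lemma is_diff_near0 (z : V -> W) (x : V) :
  (\forall y \near x, z y = 0) -> is_diff x z 0.
Proof.
move=> z0.
have zx : z x = 0 by exact: nbhs_singleton z0.
have zo : z \o shift x = cst (z x) + 0 +o_ 0 id.
  apply/eqaddoP => e e0; rewrite zx.
  have z0' : \forall h \near 0, z (h + x) = 0.
    by move: z0; rewrite (near_shift 0 x) /= subr0.
  near=> h.
  rewrite -[X in `|X|]/(z (h + x) - (0 + 0)) (near z0' h)//.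
  by rewrite addr0 subr0 normr0 mulr_ge0// ltW.
have d0 : 'd z x = 0 :> (V -> W).
  by apply/diff_unique => // y; exact: cst_continuous.
apply: DiffDef => //; apply/diff_locallyP; rewrite d0; split => //.
by move=> y; exact: cst_continuous.
Unshelve. all: by end_near. Qed.

(** The difference of the two maps vanishes near x, hence is differentiable there with zero
    differential. *)
Lemma near_eq_differentiable (f h : V -> W) (x : V) :
  {near x, f =1 h} -> differentiable f x -> differentiable h x.
Proof.
move=> fh df; rewrite (_ : h = f + (h - f)); last by rewrite addrC subrK.
apply: differentiableD => //.
suff [] : is_diff x (h - f) 0 by [].
apply: is_diff_near0; apply: filterS fh => y fhy.
by rewrite /GRing.add /= /GRing.opp /= fhy subrr.
Qed.

End Germs.

Lemma near_eq_continuous {T T' : topologicalType} (f h : T -> T') (x : T) :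
  {near x, f =1 h} -> {for x, continuous f} -> {for x, continuous h}.
Proof.
move=> fh fC; have fhx := nbhs_singleton fh.
rewrite /prop_for /continuous_at -fhx.
exact: cvg_trans (near_eq_cvg fh) fC.
Qed.

(** A continuous function keeps its sign near a point where it is nonzero. This replaces |det| by a
    constant multiple of det, which can be differentiated. *)
Lemma near_normr_sg {R : realType} {T : topologicalType} (h : T -> R) (x : T) :
  {for x, continuous h} -> h x != 0 ->
  \forall y \near x, `|h y| = Num.sg (h x) * h y.
Proof.
move=> hC; rewrite neq_lt => /orP[h0|h0]; rewrite ?(ltr0_sg h0) ?(gtr0_sg h0).
  have : \forall y \near x, h y < 0 by exact: cvgr_lt hC _ h0.
  by apply: filterS => y y0; rewrite ltr0_norm// mulN1r.
have : \forall y \near x, 0 < h y by exact: cvgr_gt hC _ h0.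
by apply: filterS => y y0; rewrite gtr0_norm// mul1r.
Qed.

Section CkTheory.
Context {R : realType} {n : nat}.
Local Notation V := 'rV[R]_n.
Implicit Types (U : set V) (k : nat).

Lemma near_open {W : Type} U (f h : V -> W) (x : V) : open U ->
  (forall y, U y -> f y = h y) -> U x -> \forall y \near x, f y = h y.
Proof. by move=> oU fh Ux; apply: filterS fh _; exact: open_nbhs_nbhs. Qed.

(** Openness of U turns equality on U into equality near each of its points, which is all that
    continuity and derivatives see. *)
Lemma Ck_ext {W : normedModType R} k U (f h : V -> W) : open U ->
  (forall x, U x -> f x = h x) -> Ck k U f -> Ck k U h.
Proof.
move=> oU; elim: k f h => [|k IH] f h fh /=.
  move=> fC x Ux; apply: near_eq_continuous (fC x Ux).
  exact: near_open oU fh Ux.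
move=> [df dfC]; split=> [x Ux|v].
  by apply: near_eq_differentiable (df x Ux); exact: near_open oU fh Ux.
apply: IH (dfC v) => x Ux; apply: near_eq_derive; exact: near_open oU fh Ux.
Qed.

Lemma Ck_sub {W : normedModType R} k U U' (f : V -> W) :
  U' `<=` U -> Ck k U f -> Ck k U' f.
Proof.
move=> UU'; elim: k f => [|k IH] f /=; first by move=> + x /UU'; apply.
by move=> [df dfC]; split=> [x /UU'/df//|v]; exact: IH.
Qed.

Lemma Ck_cont {W : normedModType R} k U (f : V -> W) x :
  Ck k U f -> U x -> {for x, continuous f}.
Proof.
case: k => [|k] /=; first exact.
by move=> [df _] /df; exact: differentiable_continuous.
Qed.

Lemma CkS {W : normedModType R} k U (f : V -> W) : Ck k.+1 U f -> Ck k U f.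
Proof.
elim: k f => [|k IH] f /=; first by move=> fC x; exact: (@Ck_cont _ 1).
by move=> [df dfC]; split=> // v; exact: IH.
Qed.

Lemma Ck_diff {W : normedModType R} k U (f : V -> W) x :
  Ck k.+1 U f -> U x -> differentiable f x.
Proof. by move=> [df _] /df. Qed.

Lemma Ck_derive {W : normedModType R} k U (f : V -> W) v :
  Ck k.+1 U f -> Ck k U ('D_v f).
Proof. by move=> [_ /(_ v)]. Qed.

(** Serves for solutions that are known to be smooth only through their local extensions. *)
Lemma Ck_local {W : normedModType R} k U (f : V -> W) :
  (forall x, U x -> exists U', U' x /\ Ck k U' f) -> Ck k U f.
Proof.
elim: k f => [|k IH] f loc.
  by move=> x /loc[U' [U'x fC]]; exact: fC.
split=> [x /loc[U' [U'x fC]]|v]; first exact: Ck_diff fC U'x.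
apply: IH => x /loc[U' [U'x fC]]; exists U'; split=> //; exact: Ck_derive.
Qed.

Lemma Ck_cst {W : normedModType R} k U (a : W) : Ck k U (fun=> a).
Proof.
elim: k a => [|k IH] a /=; first by move=> x _; exact: cst_continuous.
split=> [x _|v]; first exact: differentiable_cst.
by rewrite (_ : 'D_v _ = fun=> 0) //; apply/funext => x; exact: derive_cst.
Qed.

Lemma CkD {W : normedModType R} k U (f h : V -> W) : open U ->
  Ck k U f -> Ck k U h -> Ck k U (fun x => f x + h x).
Proof.
move=> oU; elim: k f h => [|k IH] f h /=.
  by move=> fC hC x Ux; apply: continuousD; [exact: fC|exact: hC].
move=> [df dfC] [dh dhC]; split=> [x Ux|v].
  by apply: differentiableD; [exact: df|exact: dh].
apply: (@Ck_ext _ _ U (fun x => 'D_v f x + 'D_v h x)) => //; last exact: IH.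
move=> x Ux; rewrite -[RHS]/('D_v (f + h) x) deriveD//.
  exact/diff_derivable/df.
exact/diff_derivable/dh.
Qed.

Lemma CkM k U (f h : V -> R) : open U ->
  Ck k U f -> Ck k U h -> Ck k U (fun x => f x * h x).
Proof.
move=> oU; elim: k f h => [|k IH] f h.
  by move=> fC hC x Ux; apply: continuousM; [exact: fC|exact: hC].
move=> fk hk.
have df x : U x -> differentiable f x by exact: Ck_diff fk.
have dh x : U x -> differentiable h x by exact: Ck_diff hk.
split=> [x Ux|v].
  by apply: differentiableM; [exact: df|exact: dh].
apply: (@Ck_ext _ _ U (fun x => f x * 'D_v h x + h x * 'D_v f x)) => //.
  move=> x Ux; rewrite -[RHS]/('D_v (f * h) x) deriveM//.
    exact/diff_derivable/df.
  exact/diff_derivable/dh.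
by apply: CkD => //; apply: IH => //; by [exact: CkS|exact: Ck_derive].
Qed.

Lemma CkZ {W : normedModType R} k U (a : R) (f : V -> W) : open U ->
  Ck k U f -> Ck k U (fun x => a *: f x).
Proof.
move=> oU; elim: k f => [|k IH] f /=.
  by move=> fC x Ux; apply: continuousZl_tmp; exact: fC.
move=> [df dfC]; split=> [x Ux|v].
  by apply: differentiableZ; exact: df.
apply: (@Ck_ext _ _ U (fun x => a *: 'D_v f x)) => //; last exact: IH.
move=> x Ux; rewrite -[RHS]/('D_v (a *: f) x) deriveZ//.
exact/diff_derivable/df.
Qed.

Lemma Ck_sum {W : normedModType R} k U I (r : seq I) (P : pred I)
  (F : I -> V -> W) : open U ->
  (forall i, P i -> Ck k U (F i)) -> Ck k U (fun x => \sum_(i <- r | P i) F i x).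
Proof.
move=> oU FC; elim: r => [|i r IH].
  by apply: (@Ck_ext _ _ U (fun=> 0)) (Ck_cst _ _ _) => // x _; rewrite big_nil.
case Pi : (P i).
  apply: (@Ck_ext _ _ U (fun x => F i x + \sum_(i <- r | P i) F i x)) => //.
    by move=> x _; rewrite big_cons Pi.
  by apply: CkD => //; exact: FC.
by apply: Ck_ext IH => // x _; rewrite big_cons Pi.
Qed.

Lemma Ck_prod k U I (r : seq I) (P : pred I) (F : I -> V -> R) : open U ->
  (forall i, P i -> Ck k U (F i)) -> Ck k U (fun x => \prod_(i <- r | P i) F i x).
Proof.
move=> oU FC; elim: r => [|i r IH].
  apply: (@Ck_ext _ _ U (fun=> 1 : R)) (Ck_cst _ _ _) => // x _.
  by rewrite big_nil.
case Pi : (P i).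
  apply: (@Ck_ext _ _ U (fun x => F i x * \prod_(i <- r | P i) F i x)) => //.
    by move=> x _; rewrite big_cons Pi.
  by apply: CkM => //; exact: FC.
by apply: Ck_ext IH => // x _; rewrite big_cons Pi.
Qed.

(** The derivative of 1/f is -(1/f)^2 Df, which involves 1/f only to the order that the induction
    has already reached. *)
Lemma CkV k U (f : V -> R) : open U -> (forall x, U x -> f x != 0) ->
  Ck k U f -> Ck k U (fun x => (f x)^-1).
Proof.
move=> oU f0; elim: k => [|k IH].
  by move=> fC x Ux; apply: continuousV; [exact: f0|exact: fC].
move=> fk; have df x : U x -> differentiable f x by exact: Ck_diff fk.
split=> [x Ux|v].
  by apply: differentiableV; [exact: df|exact: f0].
have fV : Ck k U (fun x => (f x)^-1) by apply: IH; exact: CkS.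
apply: (@Ck_ext _ _ U (fun x => -1 *: ((f x)^-1 * (f x)^-1 * 'D_v f x))) => //.
  move=> x Ux; rewrite deriveV//; last exact/diff_derivable/df.
    by rewrite scaleN1r scaleNr expr2 invfM.
  exact: f0.
by apply: CkZ => //; apply: CkM => //; [exact: CkM|exact: Ck_derive].
Qed.

Lemma differentiable_sqrt (f : V -> R) x : 0 < f x -> differentiable f x ->
  differentiable (fun y => Num.sqrt (f y)) x.
Proof.
move=> f0 df; apply: (differentiable_comp (g := Num.sqrt)) => //.
by apply/derivable1_diffP; have [] := is_derive1_sqrt f0.
Qed.

Lemma derive_sqrt_comp (f : V -> R) x v : 0 < f x -> differentiable f x ->
  'D_v (fun y => Num.sqrt (f y)) x = (2 * Num.sqrt (f x))^-1 * 'D_v f x.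
Proof.
move=> f0 df; rewrite deriveE; last exact: differentiable_sqrt.
have ds : differentiable Num.sqrt (f x).
  by apply/derivable1_diffP; have [] := is_derive1_sqrt f0.
rewrite (_ : (fun y => _) = Num.sqrt \o f)// diff_comp//=.
have [d <-] := is_derive1_sqrt f0.
rewrite [X in _ = _ * X]deriveE// [X in _ = X * _]deriveE//.
by rewrite -[X in 'd _ _ X = _]mulr1 linearZ mulrC.
Qed.

(** As for inverses, the derivative Df / (2 sqrt f) brings back sqrt f at the previous order only;
    positivity keeps f away from 0, where the root is not differentiable. *)
Lemma Ck_sqrt k U (f : V -> R) : open U -> (forall x, U x -> 0 < f x) ->
  Ck k U f -> Ck k U (fun x => Num.sqrt (f x)).
Proof.
move=> oU f0; elim: k => [|k IH].
  move=> fC x Ux; apply: (continuous_comp (g := Num.sqrt)); first exact: fC.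
  exact: sqrt_continuous.
move=> fk; have df x : U x -> differentiable f x by exact: Ck_diff fk.
split=> [x Ux|v].
  by apply: differentiable_sqrt; [exact: f0|exact: df].
have fs : Ck k U (fun x => Num.sqrt (f x)) by apply: IH; exact: CkS.
apply: (@Ck_ext _ _ U (fun x => (2 * Num.sqrt (f x))^-1 * 'D_v f x)) => //.
  by move=> x Ux; rewrite derive_sqrt_comp//; [exact: f0|exact: df].
apply: CkM => //; last exact: Ck_derive.
apply: CkV => //.
  by move=> x /f0 fx; rewrite mulf_neq0// gt_eqF// sqrtr_gt0.
by apply: CkM => //; exact: Ck_cst.
Qed.

End CkTheory.

(** * Matrix-valued maps and composition *)

Section CkMatrix.
Context {R : realType} {n : nat}.
Local Notation V := 'rV[R]_n.
Implicit Types (U : set V) (k : nat).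

Lemma Ck_scalel {W : normedModType R} k U (f : V -> R) (w : W) : open U ->
  Ck k U f -> Ck k U (fun x => f x *: w).
Proof.
move=> oU; elim: k f => [|k IH] f.
  by move=> fC x Ux; apply: continuousZr_tmp; exact: fC.
move=> fk; split=> [x Ux|v].
  by apply: differentiableZl; exact: Ck_diff fk Ux.
apply: (@Ck_ext _ _ _ _ U (fun x => 'D_v f x *: w)) => //; last first.
  by apply: IH; exact: Ck_derive.
move=> x Ux; have df := Ck_diff fk Ux.
by rewrite deriveE// deriveE ?diffZl//; exact: differentiableZl.
Qed.

Lemma differentiable_entry a b (F : V -> 'M[R]_(a, b)) x i j :
  differentiable F x -> differentiable (fun y => F y i j) x.
Proof.
pose entry (N : 'M[R]_(a, b)) := N i j.
move=> dF; apply: (differentiable_comp (g := entry)) => //.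
exact: differentiable_coord.
Qed.

Lemma derive_entry a b (F : V -> 'M[R]_(a, b)) x v i j :
  differentiable F x -> 'D_v (fun y => F y i j) x = 'D_v F x i j.
Proof. by move=> dF; rewrite derive_mx ?mxE//; exact: diff_derivable. Qed.

Lemma Ck_entry k U a b (F : V -> 'M[R]_(a, b)) i j : open U ->
  Ck k U F -> Ck k U (fun x => F x i j).
Proof.
move=> oU; elim: k F => [|k IH] F.
  move=> FC x Ux.
  apply: (continuous_comp (g := fun N : 'M[R]_(a, b) => N i j)); first exact: FC.
  exact: coord_continuous.
move=> Fk; split=> [x Ux|v].
  by apply: differentiable_entry; exact: Ck_diff Fk Ux.
apply: (@Ck_ext _ _ _ _ U (fun x => 'D_v F x i j)) => //; last first.
  by apply: IH; exact: Ck_derive.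
by move=> x Ux; rewrite derive_entry//; exact: Ck_diff Fk Ux.
Qed.

Lemma Ck_mx k U a b (F : V -> 'M[R]_(a, b)) : open U ->
  (forall i j, Ck k U (fun x => F x i j)) -> Ck k U F.
Proof.
move=> oU FC.
apply: (@Ck_ext _ _ _ _ U (fun x => \sum_i \sum_j F x i j *: delta_mx i j)) => //.
  by move=> x _; rewrite -matrix_sum_delta.
by do 2![apply: Ck_sum => // ? _]; exact: Ck_scalel.
Qed.

Lemma Ck_mulmx k U a b c (F : V -> 'M[R]_(a, b)) (G : V -> 'M[R]_(b, c)) :
  open U -> Ck k U F -> Ck k U G -> Ck k U (fun x => F x *m G x).
Proof.
move=> oU FC GC; apply: Ck_mx => // i j.
apply: (@Ck_ext _ _ _ _ U (fun x => \sum_l F x i l * G x l j)) => //.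
  by move=> x _; rewrite mxE.
by apply: Ck_sum => // l _; apply: CkM => //; exact: Ck_entry.
Qed.

Lemma Ck_scalemx k U a b (f : V -> R) (F : V -> 'M[R]_(a, b)) : open U ->
  Ck k U f -> Ck k U F -> Ck k U (fun x => f x *: F x).
Proof.
move=> oU fC FC; apply: Ck_mx => // i j.
apply: (@Ck_ext _ _ _ _ U (fun x => f x * F x i j)) => //.
  by move=> x _; rewrite [RHS]mxE.
by apply: CkM => //; exact: Ck_entry.
Qed.

Lemma Ck_det k U a (F : V -> 'M[R]_a) : open U ->
  (forall i j, Ck k U (fun x => F x i j)) -> Ck k U (fun x => \det (F x)).
Proof.
move=> oU FC; apply: Ck_sum => // s _; apply: CkM => //; first exact: Ck_cst.
exact: Ck_prod.
Qed.

Lemma Ck_adj k U a (F : V -> 'M[R]_a) : open U ->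
  Ck k U F -> Ck k U (fun x => \adj (F x)).
Proof.
move=> oU FC; apply: Ck_mx => // i j.
apply: (@Ck_ext _ _ _ _ U
    (fun x => (-1) ^+ (j + i) * \det (row' j (col' i (F x))))) => //.
  by move=> x _; rewrite mxE.
apply: CkM => //; first exact: Ck_cst.
apply: Ck_det => // i' j'.
apply: (@Ck_ext _ _ _ _ U (fun x => F x (lift j i') (lift i j'))) => //.
  by move=> x _; rewrite !mxE.
exact: Ck_entry.
Qed.

(** By Cramer's rule the entries of the inverse are polynomials in the entries of F divided by the
    determinant. *)
Lemma Ck_invmx k U a (F : V -> 'M[R]_a) : open U ->
  (forall x, U x -> F x \in unitmx) ->
  Ck k U F -> Ck k U (fun x => invmx (F x)).
Proof.
move=> oU Fu FC; apply: Ck_mx => // i j.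
apply: (@Ck_ext _ _ _ _ U (fun x => (\det (F x))^-1 * \adj (F x) i j)) => //.
  by move=> x Ux; rewrite /invmx (Fu x Ux) [RHS]mxE.
apply: CkM => //; last by apply: Ck_entry => //; exact: Ck_adj.
apply: CkV => // [x Ux|]; first by rewrite -unitfE -unitmxE Fu.
by apply: Ck_det => // *; exact: Ck_entry.
Qed.

Lemma chain_rule m (f : V -> 'rV[R]_m) (h : 'rV[R]_m -> R) x v :
  differentiable f x -> differentiable h (f x) ->
  'D_v (h \o f) x = \sum_j 'D_v f x 0 j * 'D_('e_j) h (f x).
Proof.
move=> df dh; rewrite deriveE; last exact: differentiable_comp.
have fE : 'd f x v = 'D_v f x by rewrite deriveE.
rewrite diff_comp//= fE [X in 'd _ _ X = _]row_sum_delta linear_sum.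
by apply: eq_bigr => j _; rewrite linearZ -deriveE.
Qed.

(** The chain rule replaces h by its partial derivatives, so the induction must run over all h at
    once. A scalar h is enough, matrix-valued maps being treated entry by entry. *)
Lemma Ck_comp k m U (U' : set 'rV[R]_m) (f : V -> 'rV[R]_m) (h : 'rV[R]_m -> R) :
  open U -> (forall x, U x -> U' (f x)) ->
  Ck k U f -> Ck k U' h -> Ck k U (h \o f).
Proof.
move=> oU fU; elim: k f h fU => [|k IH] f h fU.
  move=> fC hC x Ux; apply: continuous_comp; first exact: fC.
  exact/hC/fU.
move=> fk hk.
have df x : U x -> differentiable f x by exact: Ck_diff fk.
have dh x : U x -> differentiable h (f x) by move=> /fU; exact: Ck_diff hk.
split=> [x Ux|v]; first by apply: differentiable_comp; [exact: df|exact: dh].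
apply: (@Ck_ext _ _ _ _ U
    (fun x => \sum_j 'D_v f x 0 j * ('D_('e_j) h \o f) x)) => //.
  by move=> x Ux; rewrite chain_rule//; [exact: df|exact: dh].
apply: Ck_sum => // j _; apply: CkM => //.
  by apply: Ck_entry => //; exact: Ck_derive.
by apply: IH => //; [exact: CkS|exact: Ck_derive].
Qed.

End CkMatrix.

(** * Symmetry of second derivatives *)

Section Schwarz.
Context {R : realType} {n : nat}.
Local Notation V := 'rV[R]_n.

Lemma is_derive_line (f : V -> R) (x u : V) (s : R) :
  differentiable f (x + s *: u) ->
  is_derive s 1 (fun s => f (x + s *: u)) ('D_u f (x + s *: u)).
Proof.
move=> df; pose l s := x + s *: u.
have dl : is_diff s l (0 + *:%R^~ u) by exact: is_diffD.
have dfl : differentiable (f \o l) s by apply: differentiable_comp.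
apply: DeriveDef; first exact: diff_derivable.
rewrite deriveE// diff_comp//= diff_val deriveE//.
by congr ('d f _ _); rewrite /GRing.add/= add0r scale1r.
Qed.

Lemma mean_value_line (f : V -> R) (x u : V) (h : R) : 0 < h ->
  (forall s : R, s \in `[0, h] -> differentiable f (x + s *: u)) ->
  exists2 s : R, s \in `[0, h] & f (x + h *: u) - f x = 'D_u f (x + s *: u) * h.
Proof.
move=> h0 df.
have dline (s : R) : s \in `[0, h] ->
    is_derive s 1 (fun s => f (x + s *: u)) ('D_u f (x + s *: u)).
  by move=> /df; exact: is_derive_line.
have dline' (s : R) : s \in `]0, h[ ->
    is_derive s 1 (fun s => f (x + s *: u)) ('D_u f (x + s *: u)).
  by move=> /subset_itv_oo_cc; exact: dline.
have cline : {within `[0, h], continuous (fun s : R => f (x + s *: u))}.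
  by apply: derivable_within_continuous => s /dline[].
have [s sh] := MVT h0 dline' cline.
rewrite scale0r addr0 subr0 => fE; exists s => //.
exact: subset_itv_oo_cc.
Qed.

(** The mean value theorem is used twice: along u for y |-> f(y + hv) - f(y), then along v for the
    derivative of f in the direction u. *)
Lemma second_difference U (f : V -> R) (x u v : V) (h : R) : 0 < h ->
  Ck 2 U f ->
  (forall s t : R, s \in `[0, h] -> t \in `[0, h] -> U (x + s *: u + t *: v)) ->
  exists s t : R, [/\ s \in `[0, h], t \in `[0, h] &
    f (x + h *: u + h *: v) - f (x + h *: u) - (f (x + h *: v) - f x) =
    'D_v ('D_u f) (x + s *: u + t *: v) * h * h].
Proof.
move=> h0 f2 hU.
have h00 : 0 \in `[0, h] by rewrite in_itv/= lexx ltW.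
have hh : h \in `[0, h] by rewrite in_itv/= lexx ltW.
have hU0 (s : R) : s \in `[0, h] -> U (x + s *: u).
  by move=> hs; have := hU s 0 hs h00; rewrite scale0r addr0.
pose f' y := f (y + h *: v) - f y.
have dsh (s : V) : is_diff s (fun y : V => y + h *: v) (id + 0).
  exact: is_diffD.
have dfs (s : R) : s \in `[0, h] -> differentiable f (x + s *: u + h *: v).
  by move=> hs; apply: Ck_diff f2 _; exact: hU.
have df's (s : R) : s \in `[0, h] ->
    differentiable (f \o (fun y : V => y + h *: v)) (x + s *: u).
  by move=> hs; apply: differentiable_comp; [|exact: dfs].
have df0 (s : R) : s \in `[0, h] -> differentiable f (x + s *: u).
  by move=> hs; apply: Ck_diff f2 _; exact: hU0.
have [s hs] := @mean_value_line f' x u h h0 (fun s hs =>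
  differentiableB (df's s hs) (df0 s hs)).
rewrite -[f']/((f \o (fun y : V => y + h *: v)) - f) deriveB; last 2 first.
- exact/diff_derivable/df's.
- exact/diff_derivable/df0.
rewrite [X in (X - _) * h]deriveE; last exact: df's.
rewrite diff_comp//=; last exact: dfs.
rewrite diff_val /= -[(id + 0) u]/(u + 0) addr0 -deriveE; last exact: dfs.
have [t ht] := @mean_value_line ('D_u f) (x + s *: u) v h h0 (fun t ht =>
  Ck_diff (Ck_derive u f2) (hU s t hs ht)).
move=> -> fE; exists s, t; split => //; rewrite -fE.
Qed.

(** The second difference of f over a parallelogram is symmetric in u and v. Divided by h^2 it is a
    value of either mixed derivative at some point of the parallelogram, so continuity at x makes
    the two differ by less than any e. *)
Lemma schwarz U (f : V -> R) (x u v : V) : open U -> Ck 2 U f -> U x ->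
  'D_u ('D_v f) x = 'D_v ('D_u f) x.
Proof.
move=> oU f2 Ux.
have cuv : {for x, continuous ('D_u ('D_v f))}.
  by have := Ck_derive u (Ck_derive v f2); apply.
have cvu : {for x, continuous ('D_v ('D_u f))}.
  by have := Ck_derive v (Ck_derive u f2); apply.
apply/eqP; rewrite -subr_eq0 -normr_le0; apply/ler_addgt0Pr => e e0.
rewrite add0r.
have e20 : 0 < e / 2 by rewrite divr_gt0.
have nU : \forall y \near x, U y by exact: open_nbhs_nbhs.
have nuv : \forall y \near x, `|'D_u ('D_v f) x - 'D_u ('D_v f) y| < e / 2.
  by move/cvgrPdist_lt: cuv; apply.
have nvu : \forall y \near x, `|'D_v ('D_u f) x - 'D_v ('D_u f) y| < e / 2.
  by move/cvgrPdist_lt: cvu; apply.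
have /nbhs_normP[r /= r0 rP] : \forall y \near x,
  U y /\ (`|'D_u ('D_v f) x - 'D_u ('D_v f) y| < e / 2 /\
          `|'D_v ('D_u f) x - 'D_v ('D_u f) y| < e / 2).
  exact: filterI nU (filterI nuv nvu).
(* This step keeps the whole parallelogram inside the ball of radius r around x; the summand 1 makes
   the denominator positive and the bound strict. *)
pose h := r / (`|u| + `|v| + 1).
have D0 : 0 < `|u| + `|v| + 1 by rewrite ltr_wpDl// addr_ge0.
have h0 : 0 < h by rewrite divr_gt0.
have hr (s t : R) : s \in `[0, h] -> t \in `[0, h] ->
    ball_ Num.norm x r (x + s *: u + t *: v).
  rewrite !in_itv/= => /andP[s0 sh] /andP[t0 th].
  rewrite /ball_/= -addrA opprD addNKr normrN.
  apply: (le_lt_trans (ler_normD _ _)); rewrite !normrZ !ger0_norm//.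
  apply: (@le_lt_trans _ _ (h * `|u| + h * `|v|)).
    by apply: lerD; apply: ler_wpM2r.
  by rewrite -mulrDr /h mulrAC ltr_pdivrMr// ltr_pM2l// ltrDl.
have [|s [t [hs ht]]] := @second_difference U f x u v h h0 f2.
  by move=> s t hs ht; have [+ _] := rP _ (hr s t hs ht).
have hr' (s' t' : R) : s' \in `[0, h] -> t' \in `[0, h] ->
    ball_ Num.norm x r (x + s' *: v + t' *: u).
  by move=> hs' ht'; rewrite addrAC; exact: hr.
have [|s' [t' [hs' ht']]] := @second_difference U f x v u h h0 f2.
  by move=> s' t' hs' ht'; have [+ _] := rP _ (hr' s' t' hs' ht').
move=> E1 E2.
have : 'D_u ('D_v f) (x + s' *: v + t' *: u) =
    'D_v ('D_u f) (x + s *: u + t *: v).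
  have hn0 : h != 0 by rewrite gt_eqF.
  have sub4 (a b c d : R) : a - b - (c - d) = a - c - (b - d).
    by rewrite !opprB addrACA [RHS]addrACA [- _ - _]addrC.
  move: E1; rewrite (addrAC x (h *: v)) sub4 E2.
  move=> /(mulIf hn0)/(mulIf hn0) E; exact: esym E.
have [_ [b1 _]] := rP _ (hr' _ _ hs' ht').
have [_ [_ b2]] := rP _ (hr _ _ hs ht).
move=> E; rewrite E in b1.
rewrite [leRHS]splitr -(subrKA ('D_v ('D_u f) (x + s *: u + t *: v))).
apply: (le_trans (ler_normD _ _)); apply: lerD; first exact: ltW b1.
rewrite distrC; exact: ltW b2.
Qed.

End Schwarz.

(** * Jacobi's formula and the Piola identity *)

Section DetDerivative.
Context {R : realType} {V : normedModType R}.
Implicit Types (x v : V).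

Lemma is_derive_bigsum I (r : seq I) (P : pred I) (F : I -> V -> R)
    (dF : I -> R) x v :
  (forall i, P i -> is_derive x v (F i) (dF i)) ->
  is_derive x v (fun y => \sum_(i <- r | P i) F i y) (\sum_(i <- r | P i) dF i).
Proof.
move=> FdF; elim: r => [|i r IH].
  rewrite big_nil (_ : (fun y => _) = cst 0); first exact: is_derive_cst.
  by apply/funext => y; rewrite big_nil.
rewrite big_cons; case: ifPn => Pi; last first.
  rewrite (_ : (fun y => _) = fun y => \sum_(i <- r | P i) F i y)//.
  by apply/funext => y; rewrite big_cons (negbTE Pi).
rewrite (_ : (fun y => _) = F i + fun y => \sum_(i <- r | P i) F i y).
  by apply: is_deriveD; exact: FdF.
by apply/funext => y; rewrite big_cons Pi.
Qed.

Lemma derive_lincomb k (a : 'I_k -> R) (F : 'I_k -> V -> R) x v :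
  (forall i, derivable (F i) x v) ->
  'D_v (fun y => \sum_i a i * F i y) x = \sum_i a i * 'D_v (F i) x.
Proof.
move=> dF.
have [_ //] := is_derive_bigsum (index_enum 'I_k) (P := xpredT) (fun i _ =>
  is_deriveZ (a i) (derivableP (dF i))).
Qed.

Lemma is_derive_bigprod (I : eqType) (r : seq I) (F : I -> V -> R)
    (dF : I -> R) x v : uniq r ->
  (forall i, is_derive x v (F i) (dF i)) ->
  is_derive x v (fun y => \prod_(i <- r) F i y)
    (\sum_(i <- r) dF i * \prod_(j <- r | j != i) F j x).
Proof.
move=> + FdF; elim: r => [|i r IH] /=.
  rewrite big_nil (_ : (fun y => _) = cst 1).
    by move=> _; exact: is_derive_cst.
  by apply/funext => y; rewrite big_nil.
move=> /andP[ir ur]; have {IH} IHr := IH ur.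
rewrite (_ : (fun y => _) = F i * fun y => \prod_(i <- r) F i y); last first.
  by apply/funext => y; rewrite big_cons.
have HM := is_deriveM (FdF i) IHr.
apply: (is_derive_eq HM).
rewrite big_cons [in RHS]big_cons eqxx /= addrC; congr (_ + _).
  rewrite [LHS]mulrC; congr (_ * _); rewrite big_seq [RHS]big_seq_cond.
  by apply: eq_bigl => j; case: eqP => [->|]; rewrite ?(negbTE ir)// andbT.
rewrite scaler_sumr [LHS]big_seq [RHS]big_seq; apply: eq_bigr => j jr.
rewrite big_cons ifT; last by apply: contraNneq ir => ->.
by rewrite [LHS]mulrCA.
Qed.

(** Jacobi's formula. In the Leibniz expansion the product rule sorts the terms by the row i that is
    differentiated; those for a given i form the determinant of [B i], which is [A x] with row i
    taken from [dA]. Laplace expansion along that row gives the cofactors. *)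
Lemma is_derive_det m (A : V -> 'M[R]_m) (dA : 'M[R]_m) x v :
  (forall i j, is_derive x v (fun y => A y i j) (dA i j)) ->
  is_derive x v (fun y => \det (A y))
    (\sum_i \sum_j dA i j * cofactor (A x) i j).
Proof.
move=> AdA.
have dprod (s : 'S_m) :=
  is_derive_bigprod (index_enum_uniq _) (fun i => AdA i (s i)).
have dterm (s : 'S_m) := is_deriveM (is_derive_cst ((-1) ^+ s : R) x v) (dprod s).
apply: (is_derive_eq (is_derive_bigsum (index_enum _) (fun s _ => dterm s))).
pose B i := \matrix_(k, l) (if k == i then dA i l else A x k l).
transitivity (\sum_i \det (B i)).
  rewrite exchange_big; apply: eq_bigr => s _ /=.
  rewrite scaler0 addr0 /cst scaler_sumr; apply: eq_bigr => i _.
  congr (_ * _); rewrite [RHS](bigD1 i)//= mxE eqxx; congr (_ * _).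
  by apply: eq_bigr => j ji; rewrite mxE (negbTE ji).
apply: eq_bigr => i _; rewrite (expand_det_row _ i); apply: eq_bigr => j _.
rewrite mxE eqxx; congr (_ * (_ * \det _)); apply/matrixP => k l.
by rewrite !mxE eq_sym (negbTE (neq_lift _ _)).
Qed.

End DetDerivative.

Section Piola.
Context {R : realType} {n : nat}.
Local Notation V := 'rV[R]_n.

(** Differentials act on row vectors from the right, so the rows of [jacobian] index the directions:
    it is the transpose of the usual Jacobian matrix. *)
Lemma jacobianE (T : V -> V) x i j : differentiable T x ->
  jacobian T x i j = 'D_('e_i) (fun y => T y 0 j) x.
Proof.
move=> dT; rewrite derive_entry// deriveEjacobian//.
by rewrite -rowE [RHS]mxE.
Qed.

Lemma Ck_jacobian k (U : set V) (T : V -> V) : open U ->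
  Ck k.+1 U T -> Ck k U (jacobian T).
Proof.
move=> oU Tk; apply: Ck_mx => // i j.
apply: (@Ck_ext _ _ _ _ U ('D_('e_i) (fun y => T y 0 j))) => //.
  by move=> x Ux; rewrite jacobianE//; exact: Ck_diff Tk Ux.
by apply: Ck_derive; exact: Ck_entry.
Qed.

Lemma derivable_entry_C1 a b (U : set V) (F : V -> 'M[R]_(a, b)) x v i j :
  open U -> Ck 1 U F -> U x ->
  is_derive x v (fun y => F y i j) ('D_v F x i j).
Proof.
move=> oU F1 Ux; have dF := Ck_diff F1 Ux.
rewrite -derive_entry//; apply: derivableP.
exact/diff_derivable/differentiable_entry.
Qed.

(* With K the Jacobian matrix and C its adjugate, take the divergence of the
   rows of K C = (det K) I. By Jacobi's formula and the symmetry of second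
   derivatives all terms cancel except K d, where d is the left-hand side. *)
Lemma piola (U : set V) (T : V -> V) x (j : 'I_n) : open U -> Ck 2 U T ->
  (forall y, U y -> jacobian T y \in unitmx) -> U x ->
  \sum_i 'D_('e_i) (fun y => \adj (jacobian T y) j i) x = 0.
Proof.
move=> oU T2 Ku Ux; pose K := jacobian T; pose C y := \adj (K y).
have K1 : Ck 1 U K by exact: Ck_jacobian.
have C1 : Ck 1 U C by exact: Ck_adj.
have dK v i l := derivable_entry_C1 v i l oU K1 Ux.
have dC v i l := derivable_entry_C1 v i l oU C1 Ux.
have Ksym i l b : 'D_('e_i) K x l b = 'D_('e_l) K x i b.
  have KE (a c : 'I_n) : 'D_('e_a) K x c b =
      'D_('e_a) ('D_('e_c) (fun y => T y 0 b)) x.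
    rewrite -derive_entry; last exact: Ck_diff K1 Ux.
    apply: near_eq_derive; apply: near_open oU _ Ux => y Uy.
    by rewrite /K jacobianE//; exact: Ck_diff T2 Uy.
  have Sil := schwarz 'e_i 'e_l oU (Ck_entry 0 b oU T2) Ux.
  exact: etrans (KE i l) (etrans Sil (esym (KE l i))).
pose d : 'cV[R]_n := \col_j \sum_i 'D_('e_i) C x j i.
suff Kd : K x *m d = 0.
  have d0 : d = 0 by rewrite -[d](mulKmx (Ku x Ux)) -/(K x) Kd mulmx0.
  have := congr1 (fun c : 'cV[R]_n => c j 0) d0; rewrite !mxE => dj.
  rewrite -[RHS]dj; apply: eq_bigr => i _.
  by rewrite derive_entry//; exact: Ck_diff C1 Ux.
apply/matrixP => i o; rewrite {o}(ord1 o) !mxE.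
have prodE l : 'D_('e_l) (fun y => \sum_b K y i b * C y b l) x =
    \sum_b (K x i b * 'D_('e_l) C x b l + C x b l * 'D_('e_l) K x i b).
  apply: derive_val; apply: is_derive_bigsum => b _; exact: is_deriveM.
have detE l : (fun y => \sum_b K y i b * C y b l) =
    fun y => \det (K y) *+ (i == l).
  apply/funext => y; have := congr1 (fun M : 'M[R]_n => M i l) (mul_mx_adj (K y)).
  by rewrite !mxE.
have sum_l : \sum_l 'D_('e_l) (fun y => \sum_b K y i b * C y b l) x =
    'D_('e_i) (fun y => \det (K y)) x.
  rewrite (bigD1 i)//= big1 ?addr0 => [|l li]; rewrite detE ?eqxx//.
  rewrite (_ : (fun y => _) = cst 0) ?derive_cst//.
  by apply/funext => y; rewrite eq_sym (negbTE li).
have jac : 'D_('e_i) (fun y => \det (K y)) x =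
    \sum_l \sum_b 'D_('e_i) K x l b * C x b l.
  have [_ ->] := is_derive_det (dK 'e_i).
  by apply: eq_bigr => l _; apply: eq_bigr => b _; rewrite [C x b l]mxE.
move: sum_l; rewrite jac; under eq_bigr do rewrite prodE big_split/=.
rewrite big_split /= => /(canRL (addrK _)) => sumE.
transitivity (\sum_l \sum_b K x i b * 'D_('e_l) C x b l).
  rewrite exchange_big; apply: eq_bigr => b _.
  by rewrite [d b 0]mxE mulr_sumr.
rewrite sumE; apply/eqP; rewrite subr_eq0; apply/eqP.
apply: eq_bigr => l _; apply: eq_bigr => b _.
rewrite [LHS]mulrC; exact: (congr1 _ (Ksym i l b)).
Qed.

(** The field on the left is the Piola transform of Y. Where the derivative falls on the adjugate,
    the terms sum to zero by [piola]; in the others the chain rule produces the Jacobian K, and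
    adj(K) K = det(K) I leaves only the divergence of Y. *)
Lemma div_pullback (U : set V) (T Y : V -> V) x : open U -> Ck 2 U T ->
  (forall y, U y -> jacobian T y \in unitmx) -> U x ->
  differentiable Y (T x) ->
  \sum_i 'D_('e_i) (fun y => (Y (T y) *m \adj (jacobian T y)) 0 i) x =
  \det (jacobian T x) * \sum_j 'D_('e_j) (fun z => Y z 0 j) (T x).
Proof.
move=> oU T2 Ku Ux dY; have dT : differentiable T x by exact: Ck_diff T2 Ux.
pose K := jacobian T; pose C y := \adj (K y).
have C1 : Ck 1 U C by apply: Ck_adj => //; exact: Ck_jacobian.
have dC v i l := derivable_entry_C1 v i l oU C1 Ux.
have dYT v j : is_derive x v (fun y => Y (T y) 0 j)
    (\sum_l 'D_v T x 0 l * 'D_('e_l) (fun z => Y z 0 j) (T x)).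
  have dYj : differentiable (fun z => Y z 0 j) (T x).
    exact: differentiable_entry.
  rewrite -chain_rule//; apply: derivableP; apply: diff_derivable.
  exact: (differentiable_comp (g := fun z => Y z 0 j)).
have DE i : 'D_('e_i) (fun y => (Y (T y) *m C y) 0 i) x =
    \sum_j (Y (T x) 0 j * 'D_('e_i) C x j i +
      C x j i * \sum_l K x i l * 'D_('e_l) (fun z => Y z 0 j) (T x)).
  rewrite (_ : (fun y => _) = fun y => \sum_j Y (T y) 0 j * C y j i); last first.
    by apply/funext => y; rewrite mxE.
  apply: derive_val; apply: is_derive_eq.
    by apply: is_derive_bigsum => j _; exact: is_deriveM.
  apply: eq_bigr => j _; congr (_ + _ * _); apply: eq_bigr => l _.
  by rewrite deriveEjacobian// -rowE [X in X * _]mxE.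
under eq_bigr do rewrite DE big_split/=.
rewrite big_split /= [X in X + _]exchange_big /= [X in X + _]big1 ?add0r;
    last first.
  move=> j _; rewrite -mulr_sumr.
  rewrite -[X in _ * X](_ : \sum_i 'D_('e_i) (fun y => C y j i) x = _).
    by rewrite (piola _ oU)// mulr0.
  by apply: eq_bigr => i _; rewrite derive_entry//; exact: Ck_diff C1 Ux.
rewrite exchange_big mulr_sumr /=; apply: eq_bigr => j _.
under eq_bigr do rewrite mulr_sumr.
rewrite exchange_big /=.
have CK l : \sum_i C x j i * K x i l = \det (K x) *+ (j == l).
  by have := congr1 (fun M : 'M[R]_n => M j l) (mul_adj_mx (K x)); rewrite !mxE.
rewrite (bigD1 j)//= [X in _ + X]big1 ?addr0 => [|l lj]; last first.
  under eq_bigr do rewrite mulrA.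
  by rewrite -mulr_suml CK eq_sym (negbTE lj) mul0r.
by under eq_bigr do rewrite mulrA; rewrite -mulr_suml CK eqxx.
Qed.

End Piola.

(** * Changes of charts *)

Section PositiveDefinite.
Context {R : realType} {n : nat}.

(* On the segment from the identity to G the determinant does not vanish. *)
Lemma det_posdef (G : 'M[R]_n) :
  (forall v : 'rV[R]_n, v != 0 -> 0 < (v *m G *m v^T) 0 0) -> 0 < \det G.
Proof.
move=> Gpos; rewrite ltNge; apply/negP => Gle0.
pose H (t : R) : 'M[R]_n := (1 - t) *: 1%:M + t *: G.
(* As a polynomial in t, the determinant along the segment is subject to [poly_ivt], applied to -p
   because p is 1 at 0 and nonpositive at 1. A root t gives a kernel vector v of [H t], against v
   H(t) v^T > 0. *)
pose p : {poly R} := \det ((1 - 'X) *: 1%:M + 'X *: map_mx polyC G).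
have pE t : p.[t] = \det (H t).
  rewrite /p -horner_evalE -det_map_mx; congr (\det _); apply/matrixP => i j.
  by rewrite !mxE /= /horner_eval !hornerE; case: (i == j); rewrite ?hornerE.
have H0 : \det (H 0) = 1 by rewrite /H subr0 scale1r scale0r addr0 det1.
have H1 : \det (H 1) = \det G by rewrite /H subrr scale0r add0r scale1r.
have [|t /andP[t0 t1]] := @poly_ivt R (- p) 0 1 ler01.
  by rewrite !hornerN !pE H0 H1 oppr_le0 ler01 oppr_ge0.
rewrite rootN /root pE => /det0P[v v0 /(congr1 (fun w => (w *m v^T) 0 0))].
rewrite mul0mx [RHS]mxE /H mulmxDr -!scalemxAr mulmx1 mulmxDl -!scalemxAl.
rewrite !mxE => /eqP; rewrite gt_eqF//.
have vv0 : 0 < \sum_j v 0 j * v^T j 0.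
  have [i vi] : exists i, v 0 i != 0.
    apply/existsP; apply: contraNT v0; rewrite negb_exists => /forallP v0.
    by apply/eqP/rowP => i; rewrite mxE; apply/eqP; have := v0 i; rewrite negbK.
  rewrite (bigD1 i)//= mxE -expr2 ltr_pwDl//; first by rewrite exprn_even_gt0.
  by apply: sumr_ge0 => j _; rewrite mxE -expr2 sqr_ge0.
have := Gpos v v0; rewrite mxE => vGv0.
have [->|tn0] := eqVneq t 0; first by rewrite subr0 mul1r mul0r addr0.
apply: ltr_wpDl; first by rewrite mulr_ge0// ?subr_ge0// ltW.
by rewrite mulr_gt0// lt_neqAle eq_sym tn0.
Qed.

End PositiveDefinite.

(* Unfolding these makes failing unification problems intractable. *)
Local Opaque jacobian derive.

Section Jacobians.
Context {R : realType} {n : nat}.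
Local Notation V := 'rV[R]_n.

Lemma eq_mulmx_rV m (A A' : 'M[R]_(n, m)) :
  (forall v : V, v *m A = v *m A') -> A = A'.
Proof. by move=> AA'; apply/row_matrixP => i; rewrite !rowE AA'. Qed.

Lemma near_eq_jacobian (f h : V -> V) x : {near x, f =1 h} ->
  differentiable f x -> jacobian f x = jacobian h x.
Proof.
move=> fh df; apply: eq_mulmx_rV => v.
have dh := near_eq_differentiable fh df.
have fhv : 'D_v f x = 'D_v h x by exact: near_eq_derive fh.
exact: etrans (esym (deriveEjacobian v df)) (etrans fhv (deriveEjacobian v dh)).
Qed.

Lemma jacobian_comp (f h : V -> V) x : differentiable f x ->
  differentiable h (f x) ->
  jacobian (h \o f) x = jacobian f x *m jacobian h (f x).
Proof.
move=> df dh; apply: eq_mulmx_rV => v.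
have dhf : differentiable (h \o f) x by exact: differentiable_comp.
have E : 'D_v (h \o f) x = 'D_('D_v f x) h (f x).
  have Ec := congr1 (fun k : V -> V => k v) (diff_comp df dh).
  have Ed := congr1 ('d h (f x)) (esym (deriveE v df)).
  exact: etrans (deriveE v dhf) (etrans Ec (etrans Ed (esym (deriveE _ dh)))).
have Jv := congr1 (mulmx ^~ (jacobian h (f x))) (deriveEjacobian v df).
apply: etrans (esym (deriveEjacobian v dhf)) _.
exact: etrans E (etrans (deriveEjacobian _ dh) (etrans Jv (esym (mulmxA _ _ _)))).
Qed.

Lemma jacobian_id x : jacobian (id : V -> V) x = 1%:M.
Proof.
apply: eq_mulmx_rV => v; rewrite mulmx1 -deriveEjacobian//.
exact: derive_id.
Qed.

End Jacobians.

Section ChartImages.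
Context {R : realType} {n : nat} {B : topologicalType}.
Implicit Types (c : chart R n B) (U : set B).

Lemma chart_imgE c U x : chart_img U c x ->
  [/\ U (cinv c x), cdom c (cinv c x) & c (cinv c x) = x].
Proof. by move=> [p [Up cp] <-]; rewrite !cfunK. Qed.

Lemma mem_chart_img c U p : U p -> cdom c p -> chart_img U c (c p).
Proof. by move=> Up cp; exists p. Qed.

Lemma cinv_continuous c p : cdom c p -> cinv c x @[x --> c p] --> p.
Proof.
move=> cp; have := @cinv_cts _ _ _ c (c p) (ex_intro2 _ _ p cp erefl).
by rewrite /prop_for /continuous_at cfunK.
Qed.

(** Near a point of the image the inverse chart stays in U by continuity, and every nearby point is
    itself in the open image of the chart. *)
Lemma chart_img_open c U : open U -> open (chart_img U c).
Proof.
move=> oU; rewrite openE => x /chart_imgE[Ux cx cK].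
have nU : \forall y \near x, U (cinv c y).
  have := @cinv_continuous c (cinv c x) cx; rewrite cK; apply.
  exact: open_nbhs_nbhs.
have nD : \forall y \near x, (c @` cdom c) y.
  apply: open_nbhs_nbhs; split; first exact: cimg_open.
  by exists (cinv c x).
rewrite /interior; apply: filterS2 nU nD => y Uy [q cq qy].
by rewrite -qy in Uy *; rewrite cfunK// in Uy; exists q.
Qed.

Lemma near_cdom c p : cdom c p -> \forall q \near p, cdom c q.
Proof. by move=> cp; apply: open_nbhs_nbhs; split=> //; exact: cdom_open. Qed.

Lemma near_cinv c p (P : set B) : cdom c p ->
  (\forall q \near p, P q) -> \forall x \near c p, P (cinv c x).
Proof. by move=> cp; exact: cinv_continuous cp P. Qed.

End ChartImages.

(** * Transition Jacobians and the laws of transformation *)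

Section Transitions.
Context {R : realType} {n : nat} {B : topologicalType}.
Variable M : smoothManifold R n B.
Implicit Types (c d e : chart R n B) (U : set B) (p : B).

(** Taken at a point of B rather than at its coordinates, so that the chain rule becomes the cocycle
    identity [tjac_comp]. *)
Definition tjac c d p := jacobian (transition c d) (c p).

Lemma transition_smooth c d : atlas M c -> atlas M d ->
  smooth (chart_img (cdom d) c) (transition c d).
Proof. by move=> Mc Md; have [] := atlas_compatible Mc Md. Qed.

Lemma transitionE c d p : cdom c p -> transition c d (c p) = d p.
Proof. by move=> cp; rewrite /transition /= cfunK. Qed.

Lemma transition_differentiable c d p : atlas M c -> atlas M d ->
  cdom c p -> cdom d p -> differentiable (transition c d) (c p).
Proof.
move=> Mc Md cp dp; apply: (Ck_diff (transition_smooth Mc Md 1)).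
exact: mem_chart_img.
Qed.

(** The transition from c to e factors through d only near [c p], where the inverse of c takes
    values in the domain of d; for Jacobians this suffices. *)
Lemma tjac_comp c d e p : atlas M c -> atlas M d -> atlas M e ->
  cdom c p -> cdom d p -> cdom e p ->
  tjac c d p *m tjac d e p = tjac c e p.
Proof.
move=> Mc Md Me cp dp ep; rewrite /tjac -(transitionE d cp).
have dcd := transition_differentiable Mc Md cp dp.
have dde := transition_differentiable Md Me dp ep.
rewrite -(transitionE d cp) in dde.
rewrite -(jacobian_comp dcd dde).
apply: near_eq_jacobian; last exact: differentiable_comp.
apply: filterS (near_cinv cp (near_cdom dp)) => x dx.
by rewrite /transition /= cfunK.
Qed.

Lemma tjac_id c p : atlas M c -> cdom c p -> tjac c c p = 1%:M.
Proof.
move=> Mc cp; rewrite -(jacobian_id (c p)); apply: near_eq_jacobian.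
  have cimg : \forall x \near c p, chart_img (cdom c) c x.
    apply: open_nbhs_nbhs; split; last exact: mem_chart_img.
    exact/chart_img_open/cdom_open.
  by apply: filterS cimg => x /chart_imgE[].
exact: transition_differentiable.
Qed.

Lemma tjac_unit c d p : atlas M c -> atlas M d -> cdom c p -> cdom d p ->
  tjac c d p \in unitmx.
Proof.
move=> Mc Md cp dp.
have E : tjac c d p *m tjac d c p = 1%:M by rewrite (tjac_comp Mc) ?(tjac_id Mc).
exact: (mulmx1_unit E).1.
Qed.

Lemma componentsE c p v : components M c p v = v *m tjac (chart_at M p) c p.
Proof. by []. Qed.

Lemma components_tjac c d p v : atlas M c -> atlas M d -> cdom c p -> cdom d p ->
  components M d p v = components M c p v *m tjac c d p.
Proof.
move=> Mc Md cp dp; rewrite !componentsE -mulmxA tjac_comp//.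
  exact: atlas_chart_at.
exact: mem_chart_at.
Qed.

Lemma components_id p v : components M (chart_at M p) p v = v.
Proof.
rewrite componentsE tjac_id ?mulmx1//; first exact: atlas_chart_at.
exact: mem_chart_at.
Qed.

Lemma gramE (G : B -> 'M[R]_n) c p :
  gram M G c p = tjac c (chart_at M p) p *m G p *m (tjac c (chart_at M p) p)^T.
Proof.
apply/matrixP => i j; rewrite mxE /inner /coord_field -!/(tjac _ _ _).
move: (tjac _ _ _) => T.
by rewrite trmx_mul trmx_delta mulmxA -colE -!mulmxA -rowE !mxE.
Qed.

Lemma gram_tjac (G : B -> 'M[R]_n) c d p :
  atlas M c -> atlas M d -> cdom c p -> cdom d p ->
  gram M G c p = tjac c d p *m gram M G d p *m (tjac c d p)^T.
Proof.
move=> Mc Md cp dp; rewrite !gramE.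
rewrite -(tjac_comp Mc Md (atlas_chart_at M p) cp dp (mem_chart_at M p)).
by move: (tjac c d p) (tjac d _ p) => T T'; rewrite trmx_mul !mulmxA.
Qed.

End Transitions.

(** * Gradient and divergence in charts *)

Lemma invmx_uniq (R : comUnitRingType) n (A A' : 'M[R]_n) :
  A *m A' = 1%:M -> invmx A = A'.
Proof.
by move=> AA'; rewrite -[LHS]mulmx1 -AA' mulKmx//; exact: (mulmx1_unit AA').1.
Qed.

Section Operators.
Context {R : realType} {n : nat} {B : topologicalType}.
Variables (M : smoothManifold R n B) (g : riemannianMetric M).
Implicit Types (c d : chart R n B) (U : set B) (p : B) (f phi : B -> R)
  (X : B -> 'rV[R]_n).

Lemma gram_det_gt0 c p : atlas M c -> cdom c p -> 0 < \det (gram M g c p).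
Proof.
move=> Mc cp; rewrite gramE !det_mulmx det_tr mulrAC -expr2.
have dg : 0 < \det (g p) by apply: det_posdef => v; exact: metric_pos.
apply: mulr_gt0 => //; rewrite exprn_even_gt0//= -unitfE -unitmxE.
exact: tjac_unit Mc (atlas_chart_at M p) cp (mem_chart_at M p).
Qed.

Definition vol c (x : 'rV[R]_n) := Num.sqrt (\det (gram M g c (cinv c x))).

Lemma vol_gt0 c p : atlas M c -> cdom c p -> 0 < vol c (c p).
Proof. by move=> Mc cp; rewrite sqrtr_gt0 cfunK//; exact: gram_det_gt0. Qed.

Lemma vol_smooth c U : atlas M c -> open U -> smooth (chart_img U c) (vol c).
Proof.
move=> Mc oU k; have oUc := chart_img_open (c := c) oU; apply: Ck_sqrt => //.
  by move=> x /chart_imgE[_ cx _]; exact: gram_det_gt0.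
apply: Ck_det => // i j; apply: Ck_entry => //.
apply: Ck_sub (metric_smooth g Mc k).
by move=> x [p [_ cp] <-]; exists p.
Qed.

(** The Gram matrix changes by congruence, so its determinant changes by a square, whose root is an
    absolute value. *)
Lemma vol_tjac c d p : atlas M c -> atlas M d -> cdom c p -> cdom d p ->
  vol c (c p) = `|\det (tjac c d p)| * vol d (d p).
Proof.
move=> Mc Md cp dp; rewrite /vol !cfunK// (gram_tjac g Mc Md cp dp).
rewrite !det_mulmx det_tr mulrAC -expr2 sqrtrM ?sqr_ge0//.
by rewrite sqrtr_sqr.
Qed.

(** Let T be the transition Jacobian from the chosen chart at p to c. Partial derivatives in c
    acquire a factor T^T when passed to the chosen chart, components acquire T, and T^T (g p)^-1 T
    is the inverse of the Gram matrix of c. So the formula of [grad] keeps its form in every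
    chart. *)
Lemma grad_components c phi p : atlas M c -> cdom c p ->
  differentiable (phi \o cinv c) (c p) ->
  components M c p (grad g phi p) =
  (\row_i 'D_('e_i) (phi \o cinv c) (c p)) *m invmx (gram M g c p).
Proof.
move=> Mc cp dphi; set d := chart_at M p.
have Md : atlas M d := atlas_chart_at M p.
have dp : cdom d p := mem_chart_at M p.
have dT := transition_differentiable Md Mc dp cp.
have TE := transitionE c dp.
have dphi' : differentiable (phi \o cinv c) (transition d c (d p)) by rewrite TE.
have nearphi : \forall x \near d p,
    (phi \o cinv d) x = ((phi \o cinv c) \o transition d c) x.
  by apply: filterS (near_cinv dp (near_cdom cp)) => x cx; rewrite /= cfunK.
have rowE : \row_i 'D_('e_i) (phi \o cinv d) (d p) =
    (\row_i 'D_('e_i) (phi \o cinv c) (c p)) *m (tjac d c p)^T.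
  apply/rowP => i; rewrite !mxE.
  apply: etrans (near_eq_derive 'e_i nearphi) _.
  apply: etrans (chain_rule 'e_i dT dphi') _; rewrite TE.
  apply: eq_bigr => j _; rewrite mulrC (deriveEjacobian 'e_i dT) -/(tjac d c p).
  by rewrite -rowE !mxE.
have gE : invmx (gram M g c p) = (tjac d c p)^T *m invmx (g p) *m tjac d c p.
  apply: invmx_uniq; rewrite gramE -/d.
  have TT : (tjac c d p)^T *m (tjac d c p)^T = 1%:M.
    by rewrite -trmx_mul (tjac_comp Md Mc Md) ?(tjac_id Md)// trmx1.
  have T'T : tjac c d p *m tjac d c p = 1%:M.
    by rewrite (tjac_comp Mc Md Mc) ?(tjac_id Mc).
  have gu : g p \in unitmx.
    rewrite unitmxE unitfE gt_eqF//; apply: det_posdef => v.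
    exact: metric_pos.
  move: (tjac c d p) (tjac d c p) TT T'T => T' T TT T'T.
  by rewrite !mulmxA -[X in X *m _ *m _]mulmxA TT mulmx1 mulmxK// T'T.
by rewrite gE componentsE /grad -/d rowE !mulmxA.
Qed.

Lemma grad_smooth U phi : open U -> smooth_fun M U phi ->
  smooth_field M U (grad g phi).
Proof.
move=> oU phiS c Mc k; have oUc := chart_img_open (c := c) oU.
pose r x : 'rV[R]_n := \row_i 'D_('e_i) (phi \o cinv c) x.
apply: (@Ck_ext _ _ _ _ _ (fun x => r x *m invmx (gram M g c (cinv c x)))) => //.
  move=> x xU; have [Ux cx xE] := chart_imgE xU.
  rewrite /local_field grad_components// ?xE//.
  exact: Ck_diff (phiS c Mc 1) xU.
apply: Ck_mulmx => //.
  apply: Ck_mx => // i j.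
  apply: (@Ck_ext _ _ _ _ _ ('D_('e_j) (phi \o cinv c))) => //.
    by move=> x _; rewrite mxE.
  exact: Ck_derive (phiS c Mc k.+1).
apply: Ck_invmx => //.
  move=> x /chart_imgE[_ cx _].
  by rewrite unitmxE unitfE gt_eqF//; exact: gram_det_gt0.
by apply: Ck_sub (metric_smooth g Mc k) => x [p [_ cp] <-]; exists p.
Qed.

Lemma local_fieldZ c (a : B -> R) X x :
  local_field M c (fun p => a p *: X p) x =
  a (cinv c x) *: local_field M c X x.
Proof. by rewrite /local_field !componentsE scalemxAl. Qed.

Lemma smooth_funM U f phi : open U -> smooth_fun M U f -> smooth_fun M U phi ->
  smooth_fun M U (fun p => f p * phi p).
Proof.
move=> oU fS phiS c Mc k; have oUc := chart_img_open (c := c) oU.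
by apply: CkM => //; [exact: fS|exact: phiS].
Qed.

Lemma smooth_fieldZ U f X : open U -> smooth_fun M U f -> smooth_field M U X ->
  smooth_field M U (fun p => f p *: X p).
Proof.
move=> oU fS XS c Mc k; have oUc := chart_img_open (c := c) oU.
apply: (@Ck_ext _ _ _ _ _ (fun x => f (cinv c x) *: local_field M c X x)) => //.
  by move=> x _; rewrite local_fieldZ.
by apply: Ck_scalemx => //; [exact: fS|exact: XS].
Qed.

Lemma smooth_funV U f : open U -> (forall p, f p != 0) -> smooth_fun M U f ->
  smooth_fun M U (fun p => (f p)^-1).
Proof.
move=> oU f0 fS c Mc k; have oUc := chart_img_open (c := c) oU.
by apply: CkV => //; exact: fS.
Qed.

Lemma smooth_fun_sub U U' f : U' `<=` U -> smooth_fun M U f -> smooth_fun M U' f.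
Proof.
move=> UU' fS c Mc k; apply: Ck_sub (fS c Mc k).
by move=> x [p [/UU' Up cp] <-]; exists p.
Qed.

(** The formula of [div] with the chart freed from the point: [div] is the case where c is
    [chart_at M p]. *)
Definition div_in c X p : R :=
  (vol c (c p))^-1 *
    \sum_(i < n) 'D_('e_i) (fun x => vol c x * local_field M c X x 0 i) (c p).

Lemma density_Ck k c U X i : atlas M c -> open U -> smooth_field M U X ->
  Ck k (chart_img U c) (fun x => vol c x * local_field M c X x 0 i).
Proof.
move=> Mc oU XS; have oUc := chart_img_open (c := c) oU.
apply: CkM => //; first exact: vol_smooth.
by apply: Ck_entry => //; exact: XS.
Qed.

(** Up to a locally constant sign, the field weighted by the volume density in c is the Piola
    transform of its counterpart in d. By [div_pullback] its divergence carries the factor det of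
    the Jacobian, which cancels against the same factor in the density of c. *)
Lemma div_in_chart c d U X p : atlas M c -> atlas M d -> open U ->
  smooth_field M U X -> U p -> cdom c p -> cdom d p ->
  div_in c X p = div_in d X p.
Proof.
move=> Mc Md oU XS Up cp dp; pose T := transition c d.
pose W := chart_img (U `&` cdom d) c.
have oUd : open (U `&` cdom d) by apply: openI => //; exact: cdom_open.
have oW : open W by exact: chart_img_open.
have Wx : W (c p) by apply: mem_chart_img.
have WE x : W x -> [/\ U (cinv c x), cdom d (cinv c x), cdom c (cinv c x) &
    c (cinv c x) = x].
  by move=> /chart_imgE[[]].
have TS : smooth W T.
  move=> k; apply: Ck_sub (transition_smooth Mc Md k).
  by move=> _ [q [[_ dq] cq] <-]; exists q.
have JE x : W x -> jacobian T x = tjac c d (cinv c x).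
  by move=> /WE[_ _ _ xE]; rewrite /tjac xE.
have JU x : W x -> jacobian T x \in unitmx.
  move=> Wy; rewrite JE//; have [_ ? ? _] := WE _ Wy.
  exact: tjac_unit Mc Md _ _.
have Tp : T (c p) = d p by exact: transitionE.
pose Y z := vol d z *: local_field M d X z.
have YS : smooth (chart_img U d) Y.
  move=> k; have oUd' := chart_img_open (c := d) oU.
  by apply: Ck_scalemx => //; [exact: vol_smooth|exact: XS].
have TW x : W x -> chart_img U d (T x).
  by move=> /WE[? ? ? _]; exact: mem_chart_img.
have dY : differentiable Y (T (c p)) by apply: Ck_diff (YS 1) (TW _ Wx).
have volE x : W x -> vol c x = `|\det (jacobian T x)| * vol d (T x).
  move=> Wy; rewrite JE//; have [_ dx cx xE] := WE _ Wy.
  by rewrite -[in LHS]xE (vol_tjac Mc Md cx dx).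
have XE x : W x -> local_field M d X (T x) = local_field M c X x *m jacobian T x.
  move=> Wy; have [_ dx cx _] := WE _ Wy.
  have TK : cinv d (T x) = cinv c x by exact: cfunK.
  rewrite (JE _ Wy) /local_field TK.
  exact: components_tjac Mc Md cx dx.
pose s := Num.sg (\det (jacobian T (c p))).
have det0 : \det (jacobian T (c p)) != 0 by rewrite -unitfE -unitmxE JU.
have detC : {for c p, continuous (fun x => \det (jacobian T x))}.
  apply: (@Ck_cont _ _ _ 0 W) => //; apply: Ck_det => // i j.
  by apply: Ck_entry => //; apply: Ck_jacobian.
have sE : \forall x \near c p, `|\det (jacobian T x)| = s * \det (jacobian T x).
  exact: near_normr_sg detC det0.
have nW : \forall x \near c p, W x by exact: open_nbhs_nbhs.
(* With K the Jacobian of T, the components of X satisfy X_d = X_c K, so Y(T x) adj(K) = vol_d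
   det(K) X_c. Multiplied by s this is vol_c X_c near [c p]. *)
pose F i x := (Y (T x) *m \adj (jacobian T x)) 0 i.
have FE i : \forall x \near c p,
    vol c x * local_field M c X x 0 i = (s *: F i) x.
  apply: filterS2 nW sE => x Wx' sx; rewrite volE// sx.
  rewrite -[RHS]/(s * F i x) /F /Y XE// -scalemxAl -mulmxA mul_mx_adj.
  rewrite mul_mx_scalar !mxE.
  by rewrite -!mulrA; congr (_ * _); exact: mulrCA.
have dF i : differentiable (F i) (c p).
  apply: (@Ck_diff _ _ _ 0 W) => //; apply: Ck_entry => //; apply: Ck_mulmx => //.
    apply: Ck_mx => // i0 j; rewrite (ord1 i0).
    apply: (Ck_comp (U' := chart_img U d) (h := fun z => Y z 0 j)) => //.
    by apply: Ck_entry => //; exact: chart_img_open.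
  by apply: Ck_adj => //; exact: Ck_jacobian.
have DE i : 'D_('e_i) (fun x => vol c x * local_field M c X x 0 i) (c p) =
    s * 'D_('e_i) (F i) (c p).
  apply: etrans (near_eq_derive 'e_i (FE i)) _.
  exact: deriveZ (diff_derivable (dF i)).
pose D := \sum_(j < n) 'D_('e_j) (fun z => Y z 0 j) (d p).
have sumE :
    \sum_(i < n) 'D_('e_i) (fun x => vol c x * local_field M c X x 0 i) (c p) =
    s * (\det (jacobian T (c p)) * D).
  apply: etrans (eq_bigr _ (fun i _ => DE i)) _; rewrite -mulr_sumr.
  have := div_pullback oW (TS 2) JU Wx dY; rewrite Tp => DpE.
  exact: (congr1 (fun z => s * z) DpE).
have YE :
    \sum_(j < n) 'D_('e_j) (fun x => vol d x * local_field M d X x 0 j) (d p) = D.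
  apply: eq_bigr => j _; congr ('D_('e_j) _ _).
  by apply/funext => x; rewrite [RHS]mxE.
have volp : vol c (c p) = s * \det (jacobian T (c p)) * vol d (d p).
  rewrite -Tp -(nbhs_singleton sE); exact: volE _ Wx.
apply: etrans (congr2 (fun u w => u^-1 * w) volp sumE) _.
apply: etrans _ (esym (congr1 (fun w => (vol d (d p))^-1 * w) YE)).
have s0 : s != 0 by rewrite sgr_eq0.
have cancel (t a v w : R) : t != 0 -> a != 0 ->
    (t * a * v)^-1 * (t * (a * w)) = v^-1 * w.
  by move=> t0 a0; rewrite mulrA invfM mulrACA mulVf ?mul1r// mulf_neq0.
exact: cancel.
Qed.

(** By [div_in_chart] the varying chart inside [div] may be traded at every point for the fixed
    chart c, where the formula is manifestly smooth. *)
Lemma div_smooth U X : open U -> smooth_field M U X -> smooth_fun M U (div g X).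
Proof.
move=> oU XS c Mc k; have oUc := chart_img_open (c := c) oU.
pose D x := (vol c x)^-1 *
  \sum_(i < n) 'D_('e_i) (fun x => vol c x * local_field M c X x 0 i) x.
have DE x : chart_img U c x -> D x = div g X (cinv c x).
  move=> /chart_imgE[Ux cx xE]; have Md := atlas_chart_at M (cinv c x).
  have := div_in_chart Mc Md oU XS Ux cx (mem_chart_at M (cinv c x)).
  by rewrite {1}/div_in xE.
apply: (Ck_ext oUc DE).
apply: CkM => //.
  apply: CkV => //; last exact: vol_smooth.
  by move=> x /chart_imgE[_ cx <-]; rewrite gt_eqF//; exact: vol_gt0.
by apply: Ck_sum => // i _; apply: Ck_derive; exact: density_Ck.
Qed.

End Operators.

(** * Locality and boundary values *)

Section Locality.
Context {R : realType} {n : nat} {B : topologicalType}.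
Variables (M : smoothManifold R n B) (g : riemannianMetric M).
Implicit Types (c : chart R n B) (U Om : set B) (p : B) (f phi S : B -> R)
  (X : B -> 'rV[R]_n).

Lemma near_eq_A_op S phi psi p : (\forall q \near p, phi q = psi q) ->
  A_op g S phi p = A_op g S psi p.
Proof.
move=> E; congr (_ *: (_ *m _)); apply/rowP => i; rewrite !mxE.
exact/near_eq_derive/(near_cinv (mem_chart_at M p) E).
Qed.

Lemma near_eq_div X Y p : (\forall q \near p, X q = Y q) ->
  div g X p = div g Y p.
Proof.
move=> E; congr (_ * _); apply: eq_bigr => i _; apply: near_eq_derive.
apply: filterS (near_cinv (mem_chart_at M p) E) => x xE.
by rewrite /local_field xE.
Qed.

Lemma near_eq_Adag_op S X Y p : (\forall q \near p, X q = Y q) ->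
  Adag_op g S X p = Adag_op g S Y p.
Proof. by move=> E; congr (_ * _); exact: near_eq_div. Qed.

(** Stated for indexed sums to serve linear independence; k = 1 gives homogeneity and k = 0 the
    value at the zero field. *)
Lemma Adag_op_sum S k U (a : 'I_k -> R) (X : 'I_k -> B -> 'rV[R]_n) p :
  open U -> (forall i, smooth_field M U (X i)) -> U p ->
  Adag_op g S (fun q => \sum_i a i *: X i q) p =
  \sum_i a i * Adag_op g S (X i) p.
Proof.
move=> oU XS Up; set c := chart_at M p.
have cp : cdom c p := mem_chart_at M p.
have dX i j :
    differentiable (fun x => vol g c x * local_field M c (X i) x 0 j) (c p).
  apply: Ck_diff (density_Ck g 1 j (atlas_chart_at M p) oU (XS i)) _.
  exact: mem_chart_img.
have DE j : 'D_('e_j) (fun x => vol g c x *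
      local_field M c (fun q => \sum_i a i *: X i q) x 0 j) (c p) =
    \sum_i a i *
      'D_('e_j) (fun x => vol g c x * local_field M c (X i) x 0 j) (c p).
  rewrite -derive_lincomb => [|i]; last exact: diff_derivable (dX i j).
  apply: (congr1 (fun F => derive F (c p) 'e_j)); apply/funext => x.
  rewrite /local_field componentsE mulmx_suml summxE mulr_sumr.
  apply: eq_bigr => i _.
  by rewrite -scalemxAl -componentsE [X in _ * X]mxE mulrCA.
rewrite /Adag_op /div -/c (eq_bigr _ (fun j _ => DE j)) exchange_big /=.
rewrite !mulr_sumr; apply: eq_bigr => i _.
have assoc (s v b D : R) : s * (v * (b * D)) = b * (s * (v * D)).
  by rewrite (mulrCA v b) (mulrCA s b).
by rewrite -mulr_sumr; exact: assoc.
Qed.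

Lemma A_op_sum S k U (a : 'I_k -> R) (phi : 'I_k -> B -> R) p :
  (forall i, smooth_fun M U (phi i)) -> U p ->
  A_op g S (fun q => \sum_i a i * phi i q) p =
  \sum_i a i *: A_op g S (phi i) p.
Proof.
move=> phiS Up; set c := chart_at M p.
have dphi i : differentiable (phi i \o cinv c) (c p).
  apply: Ck_diff (phiS i c (atlas_chart_at M p) 1) _.
  exact: mem_chart_img Up (mem_chart_at M p).
rewrite /A_op /grad -/c.
have -> : \row_j 'D_('e_j) ((fun q => \sum_i a i * phi i q) \o cinv c) (c p) =
    \sum_i a i *: \row_j 'D_('e_j) (phi i \o cinv c) (c p).
  apply/rowP => j; rewrite mxE summxE.
  apply: etrans (derive_lincomb a (fun i => diff_derivable (dphi i))) _.
  by apply: eq_bigr => i _; rewrite !mxE.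
rewrite mulmx_suml scaler_sumr; apply: eq_bigr => i _.
by rewrite -scalemxAl !scalerA mulrC.
Qed.

Lemma smooth_fun_continuous U f p : smooth_fun M U f -> U p ->
  {for p, continuous f}.
Proof.
move=> fS Up; set c := chart_at M p.
have cp : cdom c p := mem_chart_at M p.
have fC : {for c p, continuous (f \o cinv c)}.
  exact: Ck_cont (fS c (atlas_chart_at M p) 0) (mem_chart_img Up cp).
apply: (@near_eq_continuous _ _ ((f \o cinv c) \o c)).
  by apply: filterS (near_cdom cp) => q cq; rewrite /= cfunK.
by apply: continuous_comp fC; exact: cfun_cts.
Qed.

(** The raw values X q are written in charts that vary with q, so they can be compared only after
    passage to the chart at p. *)
Lemma smooth_field_cvg U X p : smooth_field M U X -> U p ->
  components M (chart_at M p) q (X q) @[q --> p] --> X p.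
Proof.
move=> XS Up; set c := chart_at M p.
have cp : cdom c p := mem_chart_at M p.
have XC : {for c p, continuous (local_field M c X)}.
  exact: Ck_cont (XS c (atlas_chart_at M p) 0) (mem_chart_img Up cp).
have E : {near p, (local_field M c X \o c) =1 fun q => components M c q (X q)}.
  by apply: filterS (near_cdom cp) => q cq; rewrite /= /local_field cfunK.
have := near_eq_continuous E (continuous_comp (cfun_cts cp) XC).
by rewrite /prop_for /continuous_at components_id.
Qed.

End Locality.

Section BoundaryValues.
Context {R : realType} {n : nat} {B : topologicalType}.
Variable M : smoothManifold R n B.
Implicit Types (U Om : set B) (p : B) (f : B -> R) (X : B -> 'rV[R]_n).

Lemma within_cvg {W : normedModType R} U Om p (h h' : B -> W) (l : W) :
  open U -> U p -> (forall q, (U `&` Om) q -> h q = h' q) ->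
  h' q @[q --> p] --> l -> h q @[q --> within Om (nbhs p)] --> l.
Proof.
move=> oU Up hh' h'l.
apply: (@cvg_trans _ (h' q @[q --> within Om (nbhs p)])).
  apply: near_eq_cvg; rewrite near_withinE.
  by apply: filterS (open_nbhs_nbhs (conj oU Up)) => q Uq Oq; rewrite hh'.
apply: cvg_trans h'l; apply: cvg_app; exact: cvg_within.
Qed.

(** A local extension f' continuous at p forces the limit along Om to exist and to be f' p; it is
    unique because p lies in the closure. All boundary values below are obtained in this way. *)
Lemma extend_funE U Om f f' p : open U -> U p -> closure Om p ->
  (forall q, (U `&` Om) q -> f q = f' q) -> {for p, continuous f'} ->
  extend_fun Om f p = f' p.
Proof.
move=> oU Up clp ff' f'C; rewrite /extend_fun.
case: ifPn => [/set_mem Op|_]; first exact: ff'.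
rewrite (mem_set clp).
have ? : ProperFilter (within Om (nbhs p)) by exact: within_nbhs_proper.
by apply: cvg_lim => //; exact: within_cvg oU Up ff' f'C.
Qed.

Lemma components_within_cvg U Om X X' p : open U -> U p ->
  smooth_field M U X' -> (forall q, (U `&` Om) q -> X q = X' q) ->
  components M (chart_at M p) q (X q) @[q --> within Om (nbhs p)] --> X' p.
Proof.
move=> oU Up XS XX'; apply: within_cvg oU Up _ (smooth_field_cvg XS Up).
by move=> q /XX' ->.
Qed.

Lemma extend_fieldE U Om X X' p : open U -> U p -> closure Om p ->
  smooth_field M U X' -> (forall q, (U `&` Om) q -> X q = X' q) ->
  extend_field M Om X p = X' p.
Proof.
move=> oU Up clp XS XX'; rewrite /extend_field.
case: ifPn => [/set_mem Op|_]; first exact: XX'.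
rewrite (mem_set clp).
have ? : ProperFilter (within Om (nbhs p)) by exact: within_nbhs_proper.
by apply: cvg_lim => //; exact: components_within_cvg XS XX'.
Qed.

Lemma extend_fun_in Om f p : Om p -> extend_fun Om f p = f p.
Proof. by move=> Op; rewrite /extend_fun mem_set. Qed.

Lemma extend_field_in Om X p : Om p -> extend_field M Om X p = X p.
Proof. by move=> Op; rewrite /extend_field mem_set. Qed.

Lemma extend_fun_out Om f p : ~ closure Om p -> extend_fun Om f p = 0.
Proof.
move=> clp; rewrite /extend_fun !memNset// => /subset_closure; exact: clp.
Qed.

Lemma extend_field_out Om X p : ~ closure Om p -> extend_field M Om X p = 0.
Proof.
move=> clp; rewrite /extend_field !memNset// => /subset_closure; exact: clp.
Qed.

Lemma closureP Om p : closure Om p -> Om p \/ bdry Om p.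
Proof. by move=> clp; have [|] := pselect (Om p); [left|right]. Qed.

Lemma smooth_fun_on_interior Om f : open Om ->
  smooth_fun_on M (closure Om) f -> smooth_fun M Om f.
Proof.
move=> oOm fS c Mc k; apply: Ck_local => x /chart_imgE[Ox cx xE].
have [U [f' [oU Ux f'S ff']]] := fS (cinv c x) (subset_closure Ox).
have oUO : open (U `&` Om) by exact: openI.
have oI := chart_img_open (c := c) oUO.
exists (chart_img (U `&` Om) c); split.
  by rewrite -xE; exact: mem_chart_img.
apply: (@Ck_ext _ _ _ _ _ (f' \o cinv c)) => //.
  by move=> y /chart_imgE[[Uq /subset_closure Oq] _ _]; rewrite /= ff'.
by apply: Ck_sub (f'S c Mc k) => _ [q [[Uq _] cq] <-]; exists q.
Qed.

Lemma smooth_field_on_interior Om X : open Om ->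
  smooth_field_on M (closure Om) X -> smooth_field M Om X.
Proof.
move=> oOm XS c Mc k; apply: Ck_local => x /chart_imgE[Ox cx xE].
have [U [X' [oU Ux X'S XX']]] := XS (cinv c x) (subset_closure Ox).
have oUO : open (U `&` Om) by exact: openI.
have oI := chart_img_open (c := c) oUO.
exists (chart_img (U `&` Om) c); split.
  by rewrite -xE; exact: mem_chart_img.
apply: (@Ck_ext _ _ _ _ _ (local_field M c X')) => //.
  by move=> y /chart_imgE[[Uq /subset_closure Oq] _ _]; rewrite /local_field XX'.
by apply: Ck_sub (X'S c Mc k) => _ [q [[Uq _] cq] <-]; exists q.
Qed.

Lemma smooth_field_on_cvg Om X p : smooth_field_on M (closure Om) X ->
  closure Om p ->
  components M (chart_at M p) q (X q) @[q --> within Om (nbhs p)] --> X p.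
Proof.
move=> XS clp; have [U [X' [oU Up X'S XX']]] := XS p clp.
rewrite XX'//; apply: components_within_cvg X'S _ => //.
by move=> q [Uq /subset_closure Oq]; exact: XX'.
Qed.

(** The boundary condition of (F) does not prescribe X itself, so a linear relation between fields
    that holds on Om reaches the boundary by continuity. *)
Lemma smooth_field_on_sum_eq0 Om k (a : 'I_k -> R) (X : 'I_k -> B -> 'rV[R]_n) :
  (forall i, smooth_field_on M (closure Om) (X i)) ->
  (forall i p, ~ closure Om p -> X i p = 0) ->
  (forall p, Om p -> \sum_i a i *: X i p = 0) ->
  forall p, \sum_i a i *: X i p = 0.
Proof.
move=> XS X0 XOm p; have [clp|clp] := pselect (closure Om p); last first.
  by rewrite big1 // => i _; rewrite X0// scaler0.
have ? : ProperFilter (within Om (nbhs p)) by exact: within_nbhs_proper.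
have cvgX : \sum_i a i *: components M (chart_at M p) q (X i q)
    @[q --> within Om (nbhs p)] --> \sum_i a i *: X i p.
  apply: cvg_big => [|i _]; first exact: add_continuous.
  by apply: cvgZl_tmp; exact: smooth_field_on_cvg.
have cvg0 : \sum_i a i *: components M (chart_at M p) q (X i q)
    @[q --> within Om (nbhs p)] --> (0 : 'rV[R]_n).
  apply: cvg_near_cst; rewrite near_withinE; apply: nearW => q Oq.
  transitivity ((\sum_i a i *: X i q) *m tjac (chart_at M q) (chart_at M p) q).
    by rewrite mulmx_suml; apply: eq_bigr => i _; rewrite componentsE scalemxAl.
  by rewrite XOm// mul0mx.
exact: (cvg_unique _ cvgX cvg0).
Qed.

End BoundaryValues.

(** * The correspondence of eigenspaces *)

(** Lifting linear relations back along T is what carries independent families to independent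
    families. For maps built from limits this is checked directly, without going through
    linearity. *)
Lemma le_dimension (R : realType) (E F : lmodType R) (V : set E) (W : set F)
    (T : E -> F) :
  (forall u, V u -> W (T u)) ->
  (forall k (a : 'I_k -> R) (u : 'I_k -> E), (forall i, V (u i)) ->
    \sum_i a i *: T (u i) = 0 -> \sum_i a i *: u i = 0) ->
  (dimension V <= dimension W)%E.
Proof.
move=> VW Tinj; apply: ereal_sup_le => _ [k [u [uV uli]] <-].
exists k => //; exists (T \o u); split=> [i|a /= Ta].
  exact/VW/uV.
exact/uli/Tinj.
Qed.

Section Correspondence.
Context {R : realType} {n : nat} {B : topologicalType}.
Variables (M : smoothManifold R n B) (g : riemannianMetric M) (S : B -> R).
Hypotheses (S_smooth : smooth_fun M setT S) (S_pos : forall p, 0 < S p).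
Variables (Om : set B) (oOm : open Om).
Implicit Types (U : set B) (p : B) (phi : B -> R) (X : B -> 'rV[R]_n)
  (lambda : R).

Let S_smooth_in U : smooth_fun M U S.
Proof. by apply: smooth_fun_sub S_smooth. Qed.

Let S_neq0 p : S p != 0. Proof. by rewrite gt_eqF. Qed.

Lemma A_op_smooth U phi : open U -> smooth_fun M U phi ->
  smooth_field M U (A_op g S phi).
Proof.
move=> oU phiS; apply: smooth_fieldZ => //; last exact: grad_smooth.
move=> c Mc k; have oUc := chart_img_open (c := c) oU.
apply: (@Ck_ext _ _ _ _ _ (fun x => -1 *: (S \o cinv c) x)) => //.
  by move=> x _; rewrite scaleN1r.
by apply: CkZ => //; exact: S_smooth_in.
Qed.

Lemma Adag_op_smooth U X : open U -> smooth_field M U X ->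
  smooth_fun M U (Adag_op g S X).
Proof.
move=> oU XS; apply: smooth_funM => //; last exact: div_smooth.
exact: smooth_funV.
Qed.

Lemma A_opZ U phi lambda p : smooth_fun M U phi -> U p ->
  A_op g S (fun q => lambda * phi q) p = lambda *: A_op g S phi p.
Proof.
move=> phiS Up.
have := A_op_sum g S (fun _ : 'I_1 => lambda) (fun _ => phiS) Up.
rewrite big_ord1 => <-; congr (A_op g S _ p).
by apply/funext => q; rewrite big_ord1.
Qed.

Lemma Adag_opZ U X lambda p : open U -> smooth_field M U X -> U p ->
  Adag_op g S (fun q => lambda *: X q) p = lambda * Adag_op g S X p.
Proof.
move=> oU XS Up.
have := Adag_op_sum g S (fun _ : 'I_1 => lambda) oU (fun _ => XS) Up.
rewrite big_ord1 => <-; congr (Adag_op g S _ p).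
by apply/funext => q; rewrite big_ord1.
Qed.

Lemma near_Om p (P : B -> Prop) : Om p -> (forall q, Om q -> P q) ->
  \forall q \near p, P q.
Proof. by move=> Op OP; apply: filterS OP _; exact: open_nbhs_nbhs. Qed.

(** Inside the open set Om the extension agrees with its argument near p, and the operators see only
    germs. *)
Lemma Adag_op_extend lambda phi p : dirichlet g S Om lambda phi -> Om p ->
  Adag_op g S (extend_field M Om (A_op g S phi)) p = lambda * phi p.
Proof.
move=> [_ _ phiL _] Op; rewrite -phiL//; apply: near_eq_Adag_op.
by apply: near_Om Op _ => q Oq; exact: extend_field_in.
Qed.

Lemma A_op_extend lambda X p : divfree g S Om lambda X -> Om p ->
  A_op g S (extend_fun Om (Adag_op g S X)) p = lambda *: X p.
Proof.
move=> [_ _ XL _] Op; rewrite -XL//; apply: near_eq_A_op.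
by apply: near_Om Op _ => q Oq; exact: extend_fun_in.
Qed.

Lemma divfree_of_dirichlet lambda phi : dirichlet g S Om lambda phi ->
  divfree g S Om lambda (extend_field M Om (A_op g S phi)).
Proof.
move=> phiD; have [phi0 phiS phiL phib] := phiD; split.
- by move=> p clp; exact: extend_field_out.
- move=> p clp; have [U [phi' [oU Up phi'S E]]] := phiS p clp.
  (* Applying the operator to a local extension of phi gives a local extension of the result: phi
     and phi' agree near each point of the open set U [&] Om, and the values on the closure follow
     by taking limits. *)
  exists U, (A_op g S phi'); split=> //; first exact: A_op_smooth.
  move=> q [Uq clq]; apply: (extend_fieldE oU Uq clq); first exact: A_op_smooth.
  move=> r [Ur Or]; apply: near_eq_A_op.
  have oUO : open (U `&` Om) by exact: openI.
  apply: filterS (open_nbhs_nbhs (conj oUO (conj Ur Or))) => s [Us Os].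
  by apply: E; split=> //; exact: subset_closure.
- move=> p Op; have US := smooth_fun_on_interior oOm phiS.
  rewrite extend_field_in// -(A_opZ _ US Op); apply: near_eq_A_op.
  by apply: near_Om Op _ => q Oq; exact: Adag_op_extend.
- move=> p bp; have clp := bp.1; have [U [phi' [oU Up phi'S E]]] := phiS p clp.
  (* The boundary value of the divergence is the value at p of its continuous extension S lambda
     phi', which vanishes since phi' p = phi p = 0. *)
  have -> : 0 = S p * (lambda * phi' p).
    by rewrite -E// phib// !mulr0.
  apply: (extend_funE (f' := fun q => S q * (lambda * phi' q)) oU Up clp).
    move=> q [Uq Oq]; rewrite -E; last by split=> //; exact: subset_closure.
    by rewrite -(Adag_op_extend phiD Oq) /Adag_op mulVKf.
  apply: continuousM; first exact: smooth_fun_continuous S_smooth _.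
  by apply: continuousZl_tmp; exact: smooth_fun_continuous phi'S Up.
Qed.

Lemma dirichlet_of_divfree lambda X : divfree g S Om lambda X ->
  dirichlet g S Om lambda (extend_fun Om (Adag_op g S X)).
Proof.
move=> XD; have [X0 XS XL Xb] := XD.
have divE U X' p : open U -> U p -> closure Om p -> smooth_field M U X' ->
    (forall q, (U `&` closure Om) q -> X q = X' q) ->
    forall q, (U `&` Om) q -> div g X q = div g X' q.
  move=> oU Up clp X'S E r [Ur Or]; apply: near_eq_div.
  have oUO : open (U `&` Om) by exact: openI.
  apply: filterS (open_nbhs_nbhs (conj oUO (conj Ur Or))) => s [Us Os].
  by apply: E; split=> //; exact: subset_closure.
split.
- by move=> p clp; exact: extend_fun_out.
- move=> p clp; have [U [X' [oU Up X'S E]]] := XS p clp.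
  have AS := Adag_op_smooth oU X'S.
  exists U, (Adag_op g S X'); split=> //.
  move=> q [Uq clq]; apply: (extend_funE oU Uq clq); last first.
    exact: smooth_fun_continuous AS Uq.
  by move=> r Ur; congr (_ * _); exact: divE Up clp X'S E _ Ur.
- move=> p Op; have US := smooth_field_on_interior oOm XS.
  rewrite extend_fun_in// -(Adag_opZ _ oOm US Op); apply: near_eq_Adag_op.
  by apply: near_Om Op _ => q Oq; exact: A_op_extend.
- move=> p bp; have clp := bp.1; have [U [X' [oU Up X'S E]]] := XS p clp.
  have AS := Adag_op_smooth oU X'S.
  have XX' := divE U X' p oU Up clp X'S E.
  rewrite (extend_funE (f' := Adag_op g S X') oU Up clp); last 2 first.
  + by move=> q Uq; congr (_ * _); exact: XX'.
  + exact: smooth_fun_continuous AS Up.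
  (* By continuity of the divergence of X', its value at p is the boundary value of the divergence
     of X, zero by assumption. *)
  rewrite /Adag_op -(extend_funE oU Up clp XX') ?Xb// ?mulr0//.
  exact: smooth_fun_continuous (div_smooth g oU X'S) Up.
Qed.

Lemma Adag_op0 p : Adag_op g S (fun=> 0) p = 0.
Proof.
have X0 (i : 'I_0) : smooth_field M setT (fun=> 0) by case: i.
apply: etrans (etrans (Adag_op_sum g S (fun=> 0) openT X0 I) (big_ord0 _ _ _ _)).
by congr (Adag_op g S _ p); apply/funext => q; rewrite big_ord0.
Qed.

Lemma A_op0 p : A_op g S (fun=> 0) p = 0.
Proof.
have phi0 (i : 'I_0) : smooth_fun M setT (fun=> 0) by case: i.
apply: etrans
  (etrans (A_op_sum (p := p) g S (fun=> 0) phi0 I) (big_ord0 _ _ _ _)).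
by congr (A_op g S _ p); apply/funext => q; rewrite big_ord0.
Qed.

(** On Om, applying [Adag_op] to the relation returns lambda times the relation between the phi i;
    elsewhere every phi i vanishes, on the boundary by the Dirichlet condition. *)
Lemma extend_A_op_inj lambda k (a : 'I_k -> R) (phi : 'I_k -> B -> R) :
  lambda != 0 -> (forall i, dirichlet g S Om lambda (phi i)) ->
  \sum_i a i *: extend_field M Om (A_op g S (phi i)) = 0 ->
  \sum_i a i *: phi i = 0.
Proof.
move=> l0 phiD sum0.
suff sumphi p : \sum_i a i * phi i p = 0.
  by rewrite fct_sumE; apply/funext => p; exact: sumphi.
have [clp|clp] := pselect (closure Om p); last first.
  by rewrite big1// => i _; have [phi0 _ _ _] := phiD i; rewrite phi0// mulr0.
have [Op|bp] := closureP clp; last first.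
  by rewrite big1// => i _; have [_ _ _ phib] := phiD i; rewrite phib// mulr0.
have XS i : smooth_field M Om (extend_field M Om (A_op g S (phi i))).
  apply: smooth_field_on_interior => //.
  by have [] := divfree_of_dirichlet (phiD i).
apply: (mulfI l0); rewrite mulr0 mulr_sumr.
apply: etrans _
  (etrans (esym (Adag_op_sum g S a oOm XS Op)) (etrans _ (Adag_op0 p))).
  by apply: eq_bigr => i _; rewrite (Adag_op_extend (phiD i) Op) mulrCA.
congr (Adag_op g S _ p); apply/funext => q.
have := congr1 (fun Y : B -> 'rV[R]_n => Y q) sum0.
by rewrite fct_sumE.
Qed.

(** The same argument with [A_op] gives the relation on Om; [smooth_field_on_sum_eq0] then carries
    it to the boundary. *)
Lemma extend_Adag_op_inj lambda k (a : 'I_k -> R) (X : 'I_k -> B -> 'rV[R]_n) :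
  lambda != 0 -> (forall i, divfree g S Om lambda (X i)) ->
  \sum_i a i *: extend_fun Om (Adag_op g S (X i)) = 0 ->
  \sum_i a i *: X i = 0.
Proof.
move=> l0 XD sum0.
suff sumX p : \sum_i a i *: X i p = 0.
  by rewrite fct_sumE; apply/funext => p; exact: sumX.
move: p; apply: (smooth_field_on_sum_eq0 (M := M) (Om := Om)).
- by move=> i; have [] := XD i.
- by move=> i; have [] := XD i.
move=> p Op.
have phiS i : smooth_fun M Om (extend_fun Om (Adag_op g S (X i))).
  apply: smooth_fun_on_interior => //.
  by have [] := dirichlet_of_divfree (XD i).
apply: (scalerI l0); rewrite scaler0 scaler_sumr.
apply: etrans _ (etrans (esym (A_op_sum g S a phiS Op)) (etrans _ (A_op0 p))).
  by apply: eq_bigr => i _; rewrite (A_op_extend (XD i) Op) !scalerA mulrC.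
congr (A_op g S _ p); apply/funext => q.
have := congr1 (fun f : B -> R => f q) sum0.
by rewrite fct_sumE.
Qed.

(** Nontriviality is the lifting of relations for a family with one member. *)
Lemma nontrivial_divfree lambda phi : lambda <> 0 ->
  nontrivial_solution (dirichlet g S Om lambda) phi ->
  nontrivial_solution (divfree g S Om lambda) (extend_field M Om (A_op g S phi)).
Proof.
move=> /eqP l0 [phiD phi0]; split; first exact: divfree_of_dirichlet.
move=> X0; apply: phi0.
have := @extend_A_op_inj lambda 1 (fun=> 1) (fun=> phi) l0 (fun=> phiD).
by rewrite !big_ord1 !scale1r; exact.
Qed.

Lemma nontrivial_dirichlet lambda X : lambda <> 0 ->
  nontrivial_solution (divfree g S Om lambda) X ->
  nontrivial_solution (dirichlet g S Om lambda) (extend_fun Om (Adag_op g S X)).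
Proof.
move=> /eqP l0 [XD X0]; split; first exact: dirichlet_of_divfree.
move=> phi0; apply: X0.
have := @extend_Adag_op_inj lambda 1 (fun=> 1) (fun=> X) l0 (fun=> XD).
by rewrite !big_ord1 !scale1r; exact.
Qed.

End Correspondence.

Theorem theorem3p2 (R : realType) (n : nat) (B : topologicalType)
  (M : smoothManifold R n B) (g : riemannianMetric M)
  (S : B -> R) (S_smooth : smooth_fun M setT S) (S_pos : forall p, 0 < S p)
  (Om : set B) (Om_domain : domain Om) (Om_precompact : precompact Om)
  (Om_smooth : smooth_boundary M Om) :
  [/\ forall (lambda : R) (phi : B -> R), lambda <> 0 ->
        nontrivial_solution (dirichlet g S Om lambda) phi ->
        nontrivial_solution (divfree g S Om lambda)
          (extend_field M Om (A_op g S phi)),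
      forall (lambda : R) (X : B -> 'rV[R]_n), lambda <> 0 ->
        nontrivial_solution (divfree g S Om lambda) X ->
        nontrivial_solution (dirichlet g S Om lambda)
          (extend_fun Om (Adag_op g S X)),
      nonzero_spectrum (dirichlet g S Om) = nonzero_spectrum (divfree g S Om) &
      forall lambda : R, nonzero_spectrum (dirichlet g S Om) lambda ->
        multiplicity (dirichlet g S Om) lambda =
        multiplicity (divfree g S Om) lambda ].
Proof.
have oOm := Om_domain.1; split.
- by move=> lambda phi; exact: nontrivial_divfree.
- by move=> lambda X; exact: nontrivial_dirichlet.
- apply/seteqP; split=> lambda [l0 [u uV]]; split=> //.
    exists (extend_field M Om (A_op g S u)).
    exact: nontrivial_divfree.
  exists (extend_fun Om (Adag_op g S u)).
  exact: nontrivial_dirichlet.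
(* Multiplicities are extended reals, possibly infinite, so equality is obtained from the two
   inequalities. *)
- move=> lambda [/eqP l0 _]; apply/eqP; rewrite eq_le; apply/andP; split.
    apply: le_dimension => [phi|k a phi phiD].
      exact: divfree_of_dirichlet.
    exact: extend_A_op_inj l0 phiD.
  apply: le_dimension => [X|k a X XD].
    exact: dirichlet_of_divfree.
  exact: extend_Adag_op_inj l0 XD.
Qed.
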